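(* Let $G$ be a finite simple graph with graph Helmholtzian $\Delta_1=-\operatorname{grad}\operatorname{div}+\operatorname{curl}^*\operatorname{curl}$, and let $\lambda_1(\Delta_1)\ge\lambda_2(\Delta_1)$ be the two largest eigenvalues of $\Delta_1$, counted with multiplicity. Let $\mathbf s(\operatorname{curl}^*\operatorname{curl})$ be the multiset of eigenvalues of $\operatorname{curl}^*\operatorname{curl}$. Then: (i) If both $\lambda_1(\Delta_1)$ and $\lambda_2(\Delta_1)$ belong to $\mathbf s(\operatorname{curl}^*\operatorname{curl})$, counted with multiplicity (i.e. the multiset $\{\lambda_1(\Delta_1),\lambda_2(\Delta_1)\}$ is contained in the multiset $\mathbf s(\operatorname{curl}^*\operatorname{curl})$), then $$\lambda_1(\Delta_1)+\lambda_2(\Delta_1)\le D_1^\top(G)+D_2^\top(G).$$ (ii) If neither $\lambda_1(\Delta_1)$ nor $\lambda_2(\Delta_1)$ belongs to $\mathbf s(\operatorname{curl}^*\operatorname{curl})$, then $$\lambda_1(\Delta_1)+\lambda_2(\Delta_1)\le d_1^\top(G)+d_2^\top(G).$$ (iii) Otherwise (neither the hypothesis of (i) nor that of (ii) holds), $$\lambda_1(\Delta_1)+\lambda_2(\Delta_1)\le d_1^\top(G)+D_1^\top(G).$$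
   Context: Let $G$ be a finite simple graph with vertex set $V(G)$, edge set $E(G)$, and set of triangles $T(G)$, where a triangle is a set of three pairwise adjacent vertices. $L^2(V(G))$ is the space of functions $f:V(G)\to\mathbb R$. $L^2_\wedge(E(G))$ is the real vector space of functions $X:V(G)\times V(G)\to\mathbb R$ with $X(u,v)=-X(v,u)$ if $\{u,v\}\in E(G)$ and $X(u,v)=0$ otherwise. $L^2_\wedge(T(G))$ is the real vector space of functions $\Phi:V(G)^3\to\mathbb R$ such that $\Phi(u,v,w)=0$ if $\{u,v,w\}\notin T(G)$, and $\Phi$ is alternating (changes sign under transposition of two arguments) on triangles. These spaces carry the standard inner products: $\sum_v f(v)g(v)$; $\sum X(u,v)Y(u,v)$ summed once over each edge; $\sum\Phi(u,v,w)\Psi(u,v,w)$ summed once over each triangle. The operators are: - $\operatorname{grad}:L^2(V(G))\to L^2_\wedge(E(G))$, $(\operatorname{grad}f)(u,v)=f(v)-f(u)$ if $\{u,v\}\in E(G)$, and $0$ otherwise; - $\operatorname{div}:L^2_\wedge(E(G))\to L^2(V(G))$, $(\operatorname{div}X)(u)=\sum_{v\in V(G)}X(u,v)$; - $\operatorname{curl}:L^2_\wedge(E(G))\to L^2_\wedge(T(G))$, $(\operatorname{curl}X)(u,v,w)=X(u,v)+X(v,w)+X(w,u)$ if $\{u,v,w\}\in T(G)$, and $0$ otherwise; - $\operatorname{curl}^*$, the adjoint of $\operatorname{curl}$: $(\operatorname{curl}^*\Phi)(u,v)=\sum_{w\in V(G)}\Phi(u,v,w)$ if $\{u,v\}\in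 E(G)$, and $0$ otherwise. The graph Helmholtzian is $\Delta_1=-\operatorname{grad}\operatorname{div}+\operatorname{curl}^*\operatorname{curl}$ on $L^2_\wedge(E(G))$. All eigenvalues of $\Delta_1$ and $\operatorname{curl}^*\operatorname{curl}$ are real and nonnegative and are counted with multiplicity; if $L^2_\wedge(E(G))$ has dimension less than $i$, the $i$-th eigenvalue is taken to be $0$. For $v\in V(G)$, $\deg_G(v)$ is the number of edges incident with $v$, and $\deg_G^{(2)}(v)$ is the number of triangles containing $v$. For $i\ge1$, $d_i^\top(G)=|\{v\in V(G):\deg_G(v)\ge i\}|$ and $D_i^\top(G)=|\{v\in V(G):\deg_G^{(2)}(v)\ge i\}|$. *)

(* Defs.v *)
From HB Require Import structures.
From mathcomp Require Import all_boot all_order all_algebra.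
From mathcomp Require Import reals polyrcf ring.
Set Implicit Arguments.
Unset Strict Implicit.
Unset Printing Implicit Defensive.
Import Order.TTheory GRing.Theory Num.Theory.
Local Open Scope ring_scope.

Record sgraph := SGraph {
  vertex :> finType;
  adj : rel vertex;
  adj_sym : symmetric adj;
  adj_irrefl : irreflexive adj }.

Definition edges (G : sgraph) : {set {set G}} :=
  [set x : {set G} | [exists u, exists v, adj u v && (x == [set u; v])]].

Definition triangles (G : sgraph) : {set {set G}} :=
  [set t : {set G} | (#|t| == 3)
     && [forall u in t, forall v in t, (u != v) ==> adj u v]].

Lemma in_edges (G : sgraph) (u v : G) : ([set u; v] \in edges G) = adj u v.
Proof.
rewrite inE; apply/existsP/idP => [[a /existsP [b /andP [ab /eqP eq_ab]]]|uv];
  last by exists u; apply/existsP; exists v; rewrite uv eqxx.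
have nab : a != b by apply: contraTneq ab => ->; rewrite adj_irrefl.
have : a \in [set u; v] by rewrite eq_ab set21.
have : b \in [set u; v] by rewrite eq_ab set22.
have : u \in [set a; b] by rewrite -eq_ab set21.
have : v \in [set a; b] by rewrite -eq_ab set22.
rewrite !inE => /orP [] /eqP -> /orP [] /eqP -> //; rewrite ?orbb.
- by move=> /eqP eq_ba; rewrite eq_ba eqxx in nab.
- by rewrite adj_sym.
- by move=> _ /eqP eq_ba; rewrite eq_ba eqxx in nab.
Qed.

Definition deg (G : sgraph) (v : G) : nat := #|[set x in edges G | v \in x]|.

Definition deg2 (G : sgraph) (v : G) : nat :=
  #|[set t in triangles G | v \in t]|.

Definition d_top (G : sgraph) (i : nat) : nat := #|[set v : G | (i <= deg v)%N]|.

Definition D_top (G : sgraph) (i : nat) : nat := #|[set v : G | (i <= deg2 v)%N]|.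

(* The functions X with X t = - X (s t) where P t holds and X t = 0 elsewhere,
   presented as a kernel in order to be a {vspace _}; see altspaceP. *)
Section AltSpace.
Variables (R : fieldType) (T : finType) (P : pred T) (s : T -> T).

Definition alt_defect (X : {ffun T -> R^o}) : {ffun T -> R^o} :=
  [ffun t => if P t then X t + X (s t) else X t].

Lemma alt_defect_linear : linear alt_defect.
Proof.
move=> a X Y; apply/ffunP => t; rewrite !ffunE.
by case: ifP => // _; rewrite scalerDr addrACA.
Qed.

HB.instance Definition _ :=
  GRing.isLinear.Build R {ffun T -> R^o} {ffun T -> R^o} _ alt_defect
    alt_defect_linear.

Definition altspace : {vspace {ffun T -> R^o}} := lker (linfun alt_defect).

Lemma altspaceP (X : {ffun T -> R^o}) :
  reflect (forall t, X t = if P t then - X (s t) else 0) (X \in altspace).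
Proof.
rewrite memv_ker lfunE /=; apply: (iffP eqP) => [X0 t | XE].
  have /ffunP /(_ t) := X0; rewrite !ffunE.
  by case: ifP => // _ /eqP; rewrite addr_eq0 => /eqP.
apply/ffunP => t; rewrite !ffunE; move: (XE t).
by case: ifP => // _ ->; rewrite addNr.
Qed.

End AltSpace.

Section Spaces.
Variables (R : realType) (G : sgraph).

Definition is_edge (p : G * G) : bool := adj p.1 p.2.

Definition is_triangle (t : G * G * G) : bool :=
  [set t.1.1; t.1.2; t.2] \in triangles G.

Definition edge_space : {vspace {ffun G * G -> R^o}} :=
  altspace R is_edge (fun p => (p.2, p.1)).

Definition triangle_space : {vspace {ffun G * G * G -> R^o}} :=
  (altspace R is_triangle (fun t => (t.1.2, t.1.1, t.2))
   :&: altspace R is_triangle (fun t => (t.2, t.1.2, t.1.1))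
   :&: altspace R is_triangle (fun t => (t.1.1, t.2, t.1.2)))%VS.

Definition L2V := {ffun G -> R^o}.
Definition L2E := subvs_of edge_space.
Definition L2T := subvs_of triangle_space.

HB.instance Definition _ := Vector.on L2V.
HB.instance Definition _ := Vector.on L2E.
HB.instance Definition _ := Vector.on L2T.

Lemma is_triangle12 u v w : is_triangle (v, u, w) = is_triangle (u, v, w).
Proof. by rewrite /is_triangle /= (setUC [set v]). Qed.

Lemma is_triangle23 u v w : is_triangle (u, w, v) = is_triangle (u, v, w).
Proof. by rewrite /is_triangle /= setUAC. Qed.

Lemma is_triangle13 u v w : is_triangle (w, v, u) = is_triangle (u, v, w).
Proof. by rewrite is_triangle12 is_triangle23 is_triangle12. Qed.

Lemma L2E_anti (X : L2E) u v : vsval X (u, v) = - vsval X (v, u).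
Proof.
have /altspaceP XE := subvsP X.
rewrite (XE (u, v)) /is_edge /=; case: ifP => // uv.
by rewrite (XE (v, u)) /is_edge /= adj_sym uv oppr0.
Qed.

Definition grad_fun (f : L2V) : {ffun G * G -> R^o} :=
  [ffun p => if adj p.1 p.2 then f p.2 - f p.1 else 0].

Lemma grad_subproof f : grad_fun f \in edge_space.
Proof.
apply/altspaceP => -[u v]; rewrite !ffunE /is_edge /= (adj_sym v u).
by case: ifP => // _; rewrite opprB.
Qed.

Definition grad (f : L2V) : L2E := Subvs (grad_subproof f).

Definition div (X : L2E) : L2V := [ffun u => \sum_(v : G) vsval X (u, v)].

Definition curl_fun (X : L2E) : {ffun G * G * G -> R^o} :=
  [ffun t => let: (u, v, w) := t in
     if is_triangle t
     then vsval X (u, v) + vsval X (v, w) + vsval X (w, u) else 0].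

Lemma curl_subproof X : curl_fun X \in triangle_space.
Proof.
rewrite !memv_cap -andbA; apply/and3P; split; apply/altspaceP => -[[u v] w];
  rewrite !ffunE /=.
- rewrite (is_triangle12 u v w); case: ifP => // _.
  by rewrite (L2E_anti X v u) (L2E_anti X u w) (L2E_anti X w v); ring.
- rewrite (is_triangle13 u v w); case: ifP => // _.
  by rewrite (L2E_anti X w v) (L2E_anti X v u) (L2E_anti X u w); ring.
- rewrite (is_triangle23 u v w); case: ifP => // _.
  by rewrite (L2E_anti X u w) (L2E_anti X w v) (L2E_anti X v u); ring.
Qed.

Definition curl (X : L2E) : L2T := Subvs (curl_subproof X).

Definition curl_adj_fun (Phi : L2T) : {ffun G * G -> R^o} :=
  [ffun p => if adj p.1 p.2 then \sum_(w : G) vsval Phi (p, w) else 0].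

Lemma curl_adj_subproof Phi : curl_adj_fun Phi \in edge_space.
Proof.
apply/altspaceP => -[u v]; rewrite !ffunE /is_edge /= (adj_sym v u).
case: ifP => // _; rewrite -sumrN; apply: eq_bigr => w _.
have := subvsP Phi; rewrite !memv_cap -andbA => /and3P [/altspaceP PhiE _ _].
rewrite (PhiE (u, v, w)) /=; case: ifP => // ntri.
by rewrite (PhiE (v, u, w)) /= is_triangle12 ntri oppr0.
Qed.

Definition curl_adj (Phi : L2T) : L2E := Subvs (curl_adj_subproof Phi).

Lemma grad_linear : linear grad.
Proof.
move=> a f g; apply: val_inj; apply/ffunP => p; rewrite linearP !ffunE /=.
case: ifP => _; last by rewrite scaler0 addr0.
by rewrite scalerBr opprD addrACA.
Qed.

Lemma div_linear : linear div.
Proof.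
move=> a X Y; apply/ffunP => u; rewrite !ffunE scaler_sumr -big_split /=.
by apply: eq_bigr => v _; rewrite !ffunE.
Qed.

Lemma curl_linear : linear curl.
Proof.
move=> a X Y; apply: val_inj; apply/ffunP => -[[u v] w].
rewrite linearP !ffunE /=; case: ifP => _; last by rewrite scaler0 addr0.
by rewrite !scalerDr [in RHS]addrACA; congr (_ + _); rewrite addrACA.
Qed.

Lemma curl_adj_linear : linear curl_adj.
Proof.
move=> a Phi Psi; apply: val_inj; apply/ffunP => p; rewrite linearP !ffunE /=.
case: ifP => _; last by rewrite scaler0 addr0.
rewrite scaler_sumr -big_split /=.
by apply: eq_bigr => w _; rewrite !ffunE.
Qed.

HB.instance Definition _ := GRing.isLinear.Build R L2V L2E _ grad grad_linear.
HB.instance Definition _ := GRing.isLinear.Build R L2E L2V _ div div_linear.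
HB.instance Definition _ := GRing.isLinear.Build R L2E L2T _ curl curl_linear.
HB.instance Definition _ :=
  GRing.isLinear.Build R L2T L2E _ curl_adj curl_adj_linear.

Definition curl_adj_curl : 'End(L2E) := (linfun curl_adj \o linfun curl)%VF.

Definition helmholtzian : 'End(L2E) :=
  - (linfun grad \o linfun div)%VF + curl_adj_curl.

End Spaces.

Section Eigenvalues.
Variables (R : realType) (vT : vectType R).

Definition lchar_poly (f : 'End(vT)) : {poly R} :=
  char_poly (passmx.mxof (vbasis fullv) (vbasis fullv) f).

(* The multiset of all real eigenvalues, in nonincreasing order, each repeated
   according to its multiplicity as a root of the characteristic polynomial. *)
Definition eigenvalues (f : 'End(vT)) : seq R :=
  sort (fun x y => y <= x)
    (flatten [seq nseq (mup x (lchar_poly f)) x | x <- rootsR (lchar_poly f)]).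

(* Indexed from 1; it is 0 when there are fewer than i eigenvalues. *)
Definition lambda (i : nat) (f : 'End(vT)) : R := nth 0 (eigenvalues f) i.-1.

End Eigenvalues.

(* Inclusion of multisets represented by sequences. *)
Definition sub_multiset (T : eqType) (s t : seq T) : Prop :=
  forall x, (count_mem x s <= count_mem x t)%N.

(* Main.v *)
Require Import Defs.
From mathcomp Require Import all_boot all_order all_algebra.
From mathcomp Require Import reals.
From mathcomp Require Import polyrcf ring lra.
Set Implicit Arguments.
Unset Strict Implicit.
Unset Printing Implicit Defensive.
Import Order.TTheory GRing.Theory Num.Theory.
Local Open Scope ring_scope.

(* By the Hodge decomposition a nonzero eigenvalue of the Helmholtzian comes from
   curl^* curl (triangles) or from - grad div (edges), so it suffices to bound the
   sum of the two largest eigenvalues of each.  Edges reduce to triples by coning.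

   For a system of triples let W be the set of vertices in some triple and Q the set
   of vertices in at least two; the claim is l1 + l2 <= |W| + |Q|.  One eigenvalue is
   at most |W|, since on a complete complex the up- and down-Laplacians add up to the
   number of vertices; so assume l1 >= l2 > q = |Q|, and for l = l1, l2 put
   mu = l - q.  An isolated triple (two vertices outside Q) only supports the
   eigenvalue 3 and is treated apart.  A remaining triple is contained in Q or
   consists of a pendant vertex v outside Q and a pair inside Q; let y_v be the value
   of an eigenchain there.  Completing the square in the part inside Q, whose energy
   is at most q times its norm, eliminates that part and gives
   mu (mu + q - 2) |y|^2 <= F_mu(y), where F_mu is a sum of squares with trace
   (mu + q - 2) times the number of pendant vertices.  With two orthogonal test
   vectors for F_mu at mu = l2 - q, of Rayleigh quotients (l1 - q)(mu + q - 2) and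
   mu (mu + q - 2), the trace bound is the claim.  The first is the vector y of l1,
   or, if that fails, the indicator of more than l1 - q pendants on a common pair. *)

(** * Alternating chains on triples *)

Section Chains.
Variables (R : realFieldType) (V : finType).
Implicit Types (Phi Psi : V -> V -> V -> R) (psi : V -> V -> R) (S : {set V}).

Definition alternating Phi :=
  (forall u v w, Phi v u w = - Phi u v w)
  /\ (forall u v w, Phi u w v = - Phi u v w).

Definition bd Phi u v := \sum_w Phi u v w.

Definition cobd psi u v w := psi u v + psi v w + psi w u.

(** Sums run over ordered triples and pairs, so a triple counts six times and an edge twice; the
    constants 3 and 6 below come from this. *)
Definition sum3 (F : V -> V -> V -> R) := \sum_u \sum_v \sum_w F u v w.

Lemma eq_sum3 F G : (forall u v w, F u v w = G u v w) -> sum3 F = sum3 G.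
Proof.
by move=> FG; apply: eq_bigr => u _; apply: eq_bigr => v _; apply: eq_bigr.
Qed.

Lemma sum3D F G : sum3 (fun u v w => F u v w + G u v w) = sum3 F + sum3 G.
Proof.
rewrite /sum3 -big_split; apply: eq_bigr => u _; rewrite -big_split.
by apply: eq_bigr => v _; rewrite -big_split.
Qed.

Lemma sum3Z c F : sum3 (fun u v w => c * F u v w) = c * sum3 F.
Proof.
rewrite /sum3 mulr_sumr; apply: eq_bigr => u _; rewrite mulr_sumr.
by apply: eq_bigr => v _; rewrite mulr_sumr.
Qed.

Lemma sum3_rot F : sum3 (fun u v w => F v w u) = sum3 F.
Proof.
rewrite /sum3 exchange_big; apply: eq_bigr => u _.
by rewrite exchange_big.
Qed.

Lemma sum3_ge0 F : (forall u v w, 0 <= F u v w) -> 0 <= sum3 F.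
Proof.
move=> F0; apply: sumr_ge0 => u _; apply: sumr_ge0 => v _.
exact: sumr_ge0.
Qed.

Lemma sum3_sqr_eq0 Phi :
  sum3 (fun u v w => Phi u v w ^+ 2) = 0 -> forall u v w, Phi u v w = 0.
Proof.
move=> Phi0 u v w.
have ge0 x y : 0 <= \sum_z Phi x y z ^+ 2 by apply: sumr_ge0 => z _; apply: sqr_ge0.
have /psumr_eq0P P1 := Phi0.
have {P1}P1 := P1 (fun x _ => sumr_ge0 _ (fun y _ => ge0 x y)) u isT.
have {P1}P1 := psumr_eq0P (fun y _ => ge0 u y) P1 (erefl : xpredT v).
have /eqP := psumr_eq0P (fun z _ => sqr_ge0 (Phi u v z)) P1 (erefl : xpredT w).
by rewrite sqrf_eq0 => /eqP.
Qed.

Lemma alternating_rot Phi u v w : alternating Phi -> Phi v w u = Phi u v w.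
Proof. by case=> a12 a23; rewrite a23 a12 opprK. Qed.

Lemma bd_anti Phi u v : alternating Phi -> bd Phi v u = - bd Phi u v.
Proof. by case=> a12 _; rewrite /bd -sumrN; apply: eq_bigr => w _. Qed.

(** The three terms of [cobd psi] pair equally with [Phi], which is invariant under rotation; hence
    the factor 3. *)
Lemma bd_adj Phi psi : alternating Phi ->
  3 * (\sum_u \sum_v bd Phi u v * psi u v)
    = sum3 (fun u v w => Phi u v w * cobd psi u v w).
Proof.
move=> altPhi.
have <- : sum3 (fun u v w => Phi u v w * psi u v)
    = \sum_u \sum_v bd Phi u v * psi u v.
  by apply: eq_bigr => u _; apply: eq_bigr => v _; rewrite mulr_suml.
rewrite (@eq_sum3 (fun u v w => Phi u v w * cobd psi u v w)
  (fun u v w => (Phi u v w * psi u v + Phi v w u * psi v w)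
                + Phi w u v * psi w u)); last first.
  move=> u v w; rewrite (alternating_rot v w u altPhi).
  by rewrite (alternating_rot u v w altPhi) /cobd; ring.
rewrite !sum3D (sum3_rot (fun u v w => Phi u v w * psi u v)).
rewrite -(sum3_rot (fun u v w => Phi w u v * psi w u)).
ring.
Qed.

(* On the complete complex over S, the up- and down-Laplacians add up to |S|. *)
Lemma cobd_sqr S psi : (forall u v, psi v u = - psi u v) ->
  \sum_(a in S) \sum_(b in S) \sum_(c in S) cobd psi a b c ^+ 2
  = 3 * #|S|%:R * (\sum_(a in S) \sum_(b in S) psi a b ^+ 2)
    - 6 * \sum_(a in S) (\sum_(b in S) psi a b) ^+ 2.
Proof.
move=> anti.
pose T F := \sum_(a in S) \sum_(b in S) \sum_(c in S) F a b c : R.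
have TD F G : T (fun u v w => F u v w + G u v w) = T F + T G.
  rewrite /T -big_split; apply: eq_bigr => u _; rewrite -big_split.
  by apply: eq_bigr => v _; rewrite -big_split.
have Trot F : T (fun u v w => F v w u) = T F.
  rewrite /T exchange_big; apply: eq_bigr => u _.
  by rewrite exchange_big.
have eqT F G : (forall u v w, F u v w = G u v w) -> T F = T G.
  move=> FG; apply: eq_bigr => u _; apply: eq_bigr => v _; apply: eq_bigr => w _.
  exact: FG.
rewrite -[LHS]/(T (fun a b c => cobd psi a b c ^+ 2)).
pose sq a b (c : V) := psi a b ^+ 2.
pose cr (a b c : V) := - 2 * (psi b a * psi b c).
rewrite (eqT _ (fun a b c => ((sq a b c + sq b c a) + sq c a b)
  + ((cr a b c + cr b c a) + cr c a b))); last first.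
  move=> a b c; rewrite /cobd /sq /cr (anti a b) (anti b c) (anti c a); ring.
rewrite !TD !(Trot sq) !(Trot cr) -(Trot (fun a b c => sq c a b)).
rewrite -(Trot (fun a b c => cr c a b)) -/(T sq) -/(T cr).
have -> : T sq = #|S|%:R * \sum_(a in S) \sum_(b in S) psi a b ^+ 2.
  rewrite /T mulr_sumr; apply: eq_bigr => a _; rewrite mulr_sumr.
  by apply: eq_bigr => b _; rewrite mulr_natl /sq sumr_const.
have -> : T cr = - 2 * \sum_(a in S) (\sum_(b in S) psi a b) ^+ 2.
  rewrite /T exchange_big mulr_sumr; apply: eq_bigr => b _.
  rewrite expr2 mulr_suml mulr_sumr; apply: eq_bigr => a _.
  by rewrite !mulr_sumr; apply: eq_bigr.
ring.
Qed.

Lemma sum_in_supp S (F : V -> R) : (forall a, a \notin S -> F a = 0) ->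
  \sum_(a in S) F a = \sum_a F a.
Proof.
by move=> F0; rewrite [RHS](bigID (mem S)) /= [X in _ + X]big1 ?addr0.
Qed.

(** For alternating [Phi] the condition passes to the other two arguments. *)
Definition supported S Phi := forall u v w, u \notin S -> Phi u v w = 0.

Lemma supported2 S Phi u v w : alternating Phi -> supported S Phi ->
  v \notin S -> Phi u v w = 0.
Proof. by case=> a12 _ sPhi vS; rewrite a12 sPhi // oppr0. Qed.

Lemma supported3 S Phi u v w : alternating Phi -> supported S Phi ->
  w \notin S -> Phi u v w = 0.
Proof. by move=> [a12 a23] sPhi vS; rewrite a23 a12 opprK sPhi. Qed.

Lemma sum3_supp S Phi psi : alternating Phi -> supported S Phi ->
  sum3 (fun u v w => Phi u v w * cobd psi u v w)
  = \sum_(a in S) \sum_(b in S) \sum_(c in S) Phi a b c * cobd psi a b c.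
Proof.
move=> altPhi sPhi; rewrite /sum3 -(@sum_in_supp S); last first.
  move=> a aS; apply: big1 => b _; apply: big1 => c _.
  by rewrite sPhi // mul0r.
apply: eq_bigr => a _; rewrite -(@sum_in_supp S); last first.
  by move=> b bS; apply: big1 => c _; rewrite (supported2 _ _ altPhi sPhi) // mul0r.
apply: eq_bigr => b _; rewrite -(@sum_in_supp S) // => c cS.
by rewrite (supported3 _ _ altPhi sPhi) // mul0r.
Qed.

(* Cauchy-Schwarz in its AM-GM form, so that no square root appears. *)
Lemma bd_pairing_le S Phi psi (c : R) : alternating Phi -> supported S Phi ->
  (forall u v, psi v u = - psi u v) -> 0 < c ->
  6 * (\sum_u \sum_v bd Phi u v * psi u v)
    <= c * sum3 (fun u v w => Phi u v w ^+ 2)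
       + c^-1 * \sum_(u in S) \sum_(v in S) \sum_(w in S) cobd psi u v w ^+ 2.
Proof.
move=> altPhi sPhi anti c0.
have -> : 6 * (\sum_u \sum_v bd Phi u v * psi u v)
  = 2 * (3 * (\sum_u \sum_v bd Phi u v * psi u v)) by ring.
rewrite bd_adj // (@sum3_supp S) //.
apply: (@le_trans _ _ (c * (\sum_(u in S) \sum_(v in S) \sum_(w in S) Phi u v w ^+ 2)
   + c^-1 * \sum_(u in S) \sum_(v in S) \sum_(w in S) cobd psi u v w ^+ 2)); last first.
  rewrite lerD2r ler_pM2l //.
  rewrite [leRHS](bigID (mem S)) /= -[leLHS]addr0 lerD //; last first.
    apply: sumr_ge0 => u _; apply: sumr_ge0 => v _; apply: sumr_ge0 => w _.
    exact: sqr_ge0.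
  apply: ler_sum => u _; rewrite [leRHS](bigID (mem S)) /= -[leLHS]addr0 lerD //; last first.
    apply: sumr_ge0 => v _; apply: sumr_ge0 => w _; exact: sqr_ge0.
  apply: ler_sum => v _; rewrite [leRHS](bigID (mem S)) /= -[leLHS]addr0 lerD //.
  by apply: sumr_ge0 => w _; exact: sqr_ge0.
rewrite !mulr_sumr -big_split; apply: ler_sum => u _ /=.
rewrite !mulr_sumr -big_split; apply: ler_sum => v _ /=.
rewrite !mulr_sumr -big_split; apply: ler_sum => w _ /=.
move: (Phi u v w) (cobd psi u v w) => x y.
rewrite -subr_ge0.
have -> : c * x ^+ 2 + c^-1 * y ^+ 2 - 2 * (x * y) = c * (x - c^-1 * y) ^+ 2.
  by field; rewrite gt_eqF.
by rewrite mulr_ge0 ?sqr_ge0 // ltW.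
Qed.

Lemma bd_supp S Phi u v : alternating Phi -> supported S Phi ->
  u \notin S -> bd Phi u v = 0.
Proof. by move=> altPhi sPhi uS; apply: big1 => w _; apply: sPhi. Qed.

(** Take [psi = bd Phi] and [c = |S|] in [bd_pairing_le]: by [cobd_sqr] the last term is at most 3
    times the squared norm of [bd Phi], half of the left-hand side. *)
Lemma bd_sqr_le S Phi : alternating Phi -> supported S Phi ->
  3 * (\sum_u \sum_v bd Phi u v ^+ 2)
    <= #|S|%:R * sum3 (fun u v w => Phi u v w ^+ 2).
Proof.
move=> altPhi sPhi.
have [S0|Sn0] := eqVneq #|S| 0%N.
  rewrite big1 ?mulr0; first by rewrite mulr_ge0 ?ler0n // sum3_ge0 // => *; apply: sqr_ge0.
  move=> u _; apply: big1 => v _; rewrite (bd_supp _ altPhi sPhi) ?expr0n //.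
  by rewrite (cards0_eq S0) inE.
have s0 : 0 < #|S|%:R :> R by rewrite ltr0n lt0n.
have anti u v : bd Phi v u = - bd Phi u v by apply: bd_anti.
have := bd_pairing_le altPhi sPhi anti s0.
rewrite cobd_sqr //.
have -> : \sum_u \sum_v bd Phi u v * bd Phi u v = \sum_u \sum_v bd Phi u v ^+ 2.
  by apply: eq_bigr => u _; apply: eq_bigr => v _; rewrite expr2.
have -> : \sum_(a in S) \sum_(b in S) bd Phi a b ^+ 2 = \sum_u \sum_v bd Phi u v ^+ 2.
  rewrite -(@sum_in_supp S) => [|a aS].
    apply: eq_bigr => a _; rewrite sum_in_supp // => b bS.
    by rewrite anti (bd_supp _ altPhi sPhi) // oppr0 expr0n.
  by apply: big1 => b _; rewrite (bd_supp _ altPhi sPhi) // expr0n.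
set A := (\sum_u _); set D := (\sum_(a in S) _).
have D0 : 0 <= D by apply: sumr_ge0 => a _; apply: sqr_ge0.
have -> : #|S|%:R^-1 * (3 * #|S|%:R * A - 6 * D) = 3 * A - #|S|%:R^-1 * (6 * D).
  by field; rewrite gt_eqF.
have : 0 <= #|S|%:R^-1 * (6 * D) by rewrite !mulr_ge0 // ltW // invr_gt0.
lra.
Qed.

End Chains.

(** * The quadratic form on pendant triangles *)

Section Pendants.
Variables (R : realFieldType) (V : finType) (P Q : {set V}) (r : V -> V * V).
Hypothesis rQ : forall v, v \in P -> (r v).1 \in Q /\ (r v).2 \in Q.
Hypothesis r12 : forall v, v \in P -> (r v).1 != (r v).2.
Implicit Types (y u : V -> R) (mu : R).

(** The elementary 1-cochain of the oriented edge [p]. *)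
Definition orient (p : V * V) a b : R := (p == (a, b))%:R - (p == (b, a))%:R.

(** The contribution to the boundary, on base edges, of triangles with apex [v], base [r v] and
    value [y v]. *)
Definition spread y a b := \sum_(v in P) y v * orient (r v) a b.

Definition dot y u := \sum_(v in P) y v * u v.

(** The form F_mu of the overview. Every square is the square of a linear functional of [y], which
    is what makes Bessel's inequality applicable. *)
Definition pform mu y :=
  mu / 2 * (\sum_(a in Q) \sum_(b in Q) spread y a b ^+ 2)
  + 6^-1 * \sum_(a in Q) \sum_(b in Q) \sum_(c in Q) cobd (spread y) a b c ^+ 2.

Lemma orient_anti p a b : orient p b a = - orient p a b.
Proof. by rewrite /orient opprB. Qed.

Lemma spread_anti y a b : spread y b a = - spread y a b.
Proof.
by rewrite /spread -sumrN; apply: eq_bigr => v _; rewrite orient_anti mulrN.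
Qed.

Lemma sum_pair_row (S : {set V}) (p : V * V) a : p.2 \in S ->
  \sum_(b in S) (p == (a, b))%:R = (p.1 == a)%:R :> R.
Proof.
case: p => c d /= dS.
rewrite (bigD1 d) //= big1 ?addr0 ?xpair_eqE ?eqxx ?andbT // => b /andP[_ bd].
by rewrite xpair_eqE [d == b]eq_sym (negPf bd) andbF.
Qed.

Lemma sum_pair_col (S : {set V}) (p : V * V) a : p.1 \in S ->
  \sum_(b in S) (p == (b, a))%:R = (p.2 == a)%:R :> R.
Proof.
case: p => c d /= cS.
rewrite (bigD1 c) //= big1 ?addr0 ?xpair_eqE ?eqxx //= => b /andP[_ bd].
by rewrite xpair_eqE [c == b]eq_sym (negPf bd).
Qed.

Lemma sum_eq_id (S : {set V}) c : c \in S -> \sum_(a in S) (c == a)%:R = 1 :> R.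
Proof.
move=> cS; rewrite (bigD1 c) //= big1 ?addr0 ?eqxx // => b /andP[_ bc].
by rewrite eq_sym (negPf bc).
Qed.

Lemma sum_orient_row (S : {set V}) (p : V * V) a : p.1 \in S -> p.2 \in S ->
  \sum_(b in S) orient p a b = (p.1 == a)%:R - (p.2 == a)%:R.
Proof. by move=> p1S p2S; rewrite sumrB sum_pair_row // sum_pair_col. Qed.

Lemma orient_sqr (p : V * V) a b : p.1 != p.2 ->
  orient p a b ^+ 2 = (p == (a, b))%:R + (p == (b, a))%:R.
Proof.
move=> p12; rewrite /orient.
case: eqP => [e1|_]; case: eqP => [e2|_];
  rewrite /= ?subr0 ?sub0r ?addr0 ?add0r ?sqrrN ?expr1n ?expr0n //.
by move: p12; rewrite {1}e1 e2 eqxx.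
Qed.

Lemma sum_orient_sqr (S : {set V}) (p : V * V) : p.1 != p.2 -> p.1 \in S -> p.2 \in S ->
  \sum_(a in S) \sum_(b in S) orient p a b ^+ 2 = 2.
Proof.
move=> p12 p1S p2S.
under eq_bigr => a _.
  under eq_bigr => b _ do rewrite orient_sqr //.
  rewrite big_split /= sum_pair_row // sum_pair_col //.
over.
by rewrite big_split /= !sum_eq_id.
Qed.

Lemma sum_orient_row_sqr (S : {set V}) (p : V * V) : p.1 != p.2 -> p.1 \in S -> p.2 \in S ->
  \sum_(a in S) (\sum_(b in S) orient p a b) ^+ 2 = 2.
Proof.
move=> p12 p1S p2S.
rewrite (eq_bigr (fun a => (p.1 == a)%:R + (p.2 == a)%:R)).
  by rewrite big_split /= !sum_eq_id.
move=> a _; rewrite sum_orient_row //.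
case: eqP => [<-|_]; last by rewrite sub0r sqrrN add0r; case: eqP; rewrite ?expr1n ?expr0n.
by rewrite eq_sym (negPf p12) subr0 addr0 expr1n.
Qed.

(** An edge inside [S] lies in |S| - 2 triples of [S], each counted in six orders. *)
Lemma cobd_orient_sqr (S : {set V}) (p : V * V) : p.1 != p.2 -> p.1 \in S -> p.2 \in S ->
  \sum_(a in S) \sum_(b in S) \sum_(c in S) cobd (orient p) a b c ^+ 2
  = 6 * (#|S|%:R - 2).
Proof.
move=> p12 p1S p2S; rewrite cobd_sqr; last exact: orient_anti.
by rewrite sum_orient_sqr // sum_orient_row_sqr //; ring.
Qed.

Lemma orient_cube (p : V * V) a b : p.1 != p.2 -> orient p a b ^+ 3 = orient p a b.
Proof.
move=> p12; rewrite exprS orient_sqr // /orient.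
by case: eqP => _; case: eqP => _ /=; ring.
Qed.

(** Multiplied by |u|^2, the difference of the two sides is the squared norm of |u|^2 g - (u.g)
    u. *)
Lemma dot_sqr_le (u g : V -> R) : dot u g ^+ 2 <= dot u u * dot g g.
Proof.
have u0 : 0 <= dot u u by apply: sumr_ge0 => v _; rewrite -expr2 sqr_ge0.
have := u0; rewrite le_eqVlt => /orP[/eqP uu0|u_gt0].
  rewrite -uu0 mul0r [dot u g]big1 ?expr0n // => v vP.
  have /eqP := psumr_eq0P (fun v _ => sqr_ge0 (u v) : 0 <= u v * u v) (esym uu0) vP.
  by rewrite mulf_eq0 orbb => /eqP ->; rewrite mul0r.
rewrite -subr_ge0 -(pmulr_rge0 _ u_gt0).
have -> : dot u u * (dot u u * dot g g - dot u g ^+ 2)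
  = \sum_(v in P) (dot u u * g v - dot u g * u v) ^+ 2.
  rewrite (eq_bigr (fun v => dot u u ^+ 2 * (g v * g v) + (dot u g ^+ 2 * (u v * u v)
      + (- 2 * dot u u * dot u g) * (u v * g v)))); last by move=> v _; ring.
  rewrite !big_split /= -!mulr_sumr -/(dot g g) -/(dot u g) -/(dot u u); ring.
by apply: sumr_ge0 => v _; apply: sqr_ge0.
Qed.

(** The difference is the squared norm of [g] minus its projection onto the span of [u1] and
    [u2]. *)
Lemma bessel (u1 u2 g : V -> R) : 0 < dot u1 u1 -> 0 < dot u2 u2 ->
  dot u1 u2 = 0 ->
  dot u1 g ^+ 2 / dot u1 u1 + dot u2 g ^+ 2 / dot u2 u2 <= dot g g.
Proof.
move=> n1 n2 o12; rewrite -subr_ge0.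
set N1 := dot u1 u1 in n1 *; set N2 := dot u2 u2 in n2 *.
set G1 := dot u1 g; set G2 := dot u2 g.
have -> : dot g g - (G1 ^+ 2 / N1 + G2 ^+ 2 / N2)
  = \sum_(v in P) (g v - G1 / N1 * u1 v - G2 / N2 * u2 v) ^+ 2.
  rewrite (eq_bigr (fun v => g v * g v + ((- 2 * (G1 / N1)) * (u1 v * g v)
     + ((- 2 * (G2 / N2)) * (u2 v * g v) + ((G1 / N1) ^+ 2 * (u1 v * u1 v)
     + ((G2 / N2) ^+ 2 * (u2 v * u2 v)
     + (2 * (G1 / N1) * (G2 / N2)) * (u1 v * u2 v))))))); last by move=> v _; ring.
  rewrite !big_split /= -!mulr_sumr -/(dot g g) -/(dot u1 g) -/(dot u2 g).
  rewrite -/(dot u1 u1) -/(dot u2 u2) -/(dot u1 u2) o12 -/N1 -/N2 -/G1 -/G2.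
  by field; rewrite !gt_eqF.
by apply: sumr_ge0 => v _; apply: sqr_ge0.
Qed.

Lemma spreadE y a b : spread y a b = dot y (fun v => orient (r v) a b).
Proof. by []. Qed.

Lemma cobd_spread y a b c :
  cobd (spread y) a b c = dot y (fun v => cobd (orient (r v)) a b c).
Proof.
rewrite /cobd /spread /dot -!big_split; apply: eq_bigr => v _.
by rewrite !mulrDr.
Qed.

(* The right-hand side is the trace of pform mu; the bound is Bessel's inequality
   for each of the squares that make up the form. *)
Lemma pform_trace mu (u1 u2 : V -> R) : 0 <= mu ->
  0 < dot u1 u1 -> 0 < dot u2 u2 -> dot u1 u2 = 0 ->
  pform mu u1 / dot u1 u1 + pform mu u2 / dot u2 u2
    <= #|P|%:R * (mu + #|Q|%:R - 2).
Proof.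
move=> mu0 n1 n2 o12.
(* Each pendant contributes (mu / 2) 2 = mu through the first sum and (1 / 6) 6 (|Q| - 2) through
   the second. *)
have -> : #|P|%:R * (mu + #|Q|%:R - 2) =
  mu / 2 * (\sum_(a in Q) \sum_(b in Q)
    dot (fun v => orient (r v) a b) (fun v => orient (r v) a b))
  + 6^-1 * \sum_(a in Q) \sum_(b in Q) \sum_(c in Q)
    dot (fun v => cobd (orient (r v)) a b c) (fun v => cobd (orient (r v)) a b c).
  have -> : \sum_(a in Q) \sum_(b in Q)
     dot (fun v => orient (r v) a b) (fun v => orient (r v) a b) = #|P|%:R * 2.
    rewrite (eq_bigr (fun a => \sum_(v in P) \sum_(b in Q) orient (r v) a b ^+ 2)); last first.
      move=> a _; rewrite exchange_big; apply: eq_bigr => v _.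
      by apply: eq_bigr => b _; rewrite expr2.
    rewrite exchange_big mulr_natl -sumr_const; apply: eq_bigr => v vP.
    by have [? ?] := rQ vP; rewrite sum_orient_sqr // r12.
  have -> : \sum_(a in Q) \sum_(b in Q) \sum_(c in Q)
    dot (fun v => cobd (orient (r v)) a b c) (fun v => cobd (orient (r v)) a b c)
    = #|P|%:R * (6 * (#|Q|%:R - 2)).
    rewrite (eq_bigr (fun a => \sum_(v in P) \sum_(b in Q) \sum_(c in Q)
       cobd (orient (r v)) a b c ^+ 2)); last first.
      move=> a _; rewrite [RHS]exchange_big; apply: eq_bigr => b _.
      rewrite [RHS]exchange_big; apply: eq_bigr => c _.
      by apply: eq_bigr => v _; rewrite expr2.
    rewrite exchange_big mulr_natl -sumr_const; apply: eq_bigr => v vP.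
    by have [? ?] := rQ vP; rewrite cobd_orient_sqr // r12.
  by field.
have -> : pform mu u1 / dot u1 u1 + pform mu u2 / dot u2 u2 =
  mu / 2 * (\sum_(a in Q) \sum_(b in Q)
      (spread u1 a b ^+ 2 / dot u1 u1 + spread u2 a b ^+ 2 / dot u2 u2))
  + 6^-1 * \sum_(a in Q) \sum_(b in Q) \sum_(c in Q)
    (cobd (spread u1) a b c ^+ 2 / dot u1 u1 + cobd (spread u2) a b c ^+ 2 / dot u2 u2).
  rewrite /pform.
  under [X in _ = mu / 2 * X + _]eq_bigr => a _ do rewrite big_split -!mulr_suml /=.
  under [X in _ = _ + 6^-1 * X]eq_bigr => a _.
    under eq_bigr => b _ do rewrite big_split -!mulr_suml /=.
    rewrite big_split -!mulr_suml /=.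
  over.
  rewrite !big_split -!mulr_suml /=.
  by ring.
apply: lerD; apply: ler_wpM2l; rewrite ?divr_ge0 ?invr_ge0 //.
  by apply: ler_sum => a _; apply: ler_sum => b _; rewrite !spreadE bessel.
apply: ler_sum => a _; apply: ler_sum => b _; apply: ler_sum => c _.
by rewrite !cobd_spread bessel.
Qed.

Lemma pformE mu y : pform mu y =
  (mu + #|Q|%:R) / 2 * (\sum_(a in Q) \sum_(b in Q) spread y a b ^+ 2)
  - \sum_(a in Q) (\sum_(b in Q) spread y a b) ^+ 2.
Proof.
rewrite /pform cobd_sqr; last exact: spread_anti.
by field.
Qed.

Lemma pform_shift mu nu y : pform nu y =
  pform mu y + (nu - mu) / 2 * (\sum_(a in Q) \sum_(b in Q) spread y a b ^+ 2).
Proof. by rewrite /pform; ring. Qed.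

(** Both sides vanish unless [p] is (a, b) or (b, a); then [orient p] is [orient (a, b)] up to the
    sign [orient p a b]. *)
Lemma orient_mul (p : V * V) a b c d : p.1 != p.2 -> 
  orient p a b * orient p c d = orient p a b ^+ 2 * orient (a, b) c d.
Proof.
move=> p12; rewrite orient_sqr // {1}/orient.
case: eqP => [e1|_]; case: eqP => [e2|_]; rewrite /= ?subr0 ?sub0r ?addr0 ?add0r ?mul0r //.
- by move: p12; rewrite {1}e1 e2 eqxx.
- by rewrite e1.
- by rewrite e2 /orient !xpair_eqE [(b == c) && _]andbC [(b == d) && _]andbC; ring.
Qed.

(** For a != b this counts the pendants whose base is the pair {a, b}, in either orientation. *)
Definition fiber a b := \sum_(v in P) orient (r v) a b ^+ 2.

Lemma dot_fiber a b :
  dot (fun v => orient (r v) a b) (fun v => orient (r v) a b) = fiber a b.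
Proof. by apply: eq_bigr => v _; rewrite expr2. Qed.

Lemma spread_fiber a b c d :
  spread (fun v => orient (r v) a b) c d = fiber a b * orient (a, b) c d.
Proof.
rewrite /spread /fiber mulr_suml; apply: eq_bigr => v vP.
by rewrite orient_mul // r12.
Qed.

(** By [dot_fiber] the squared norm of this vector is [fiber a b], so its Rayleigh quotient is
    [fiber a b] times mu + |Q| - 2: a crowded base gives a good test vector. *)
Lemma pform_fiber mu a b : a \in Q -> b \in Q -> a != b ->
  pform mu (fun v => orient (r v) a b) = fiber a b ^+ 2 * (mu + #|Q|%:R - 2).
Proof.
move=> aQ bQ ab; rewrite pformE.
under eq_bigr => c _.
  under eq_bigr => d _ do rewrite spread_fiber exprMn.
  rewrite -mulr_sumr.
over.
under [X in _ - X]eq_bigr => c _.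
  under eq_bigr => d _ do rewrite spread_fiber.
  rewrite -mulr_sumr exprMn.
over.
rewrite -!mulr_sumr (@sum_orient_sqr Q (a, b)) // (@sum_orient_row_sqr Q (a, b)) //.
by field.
Qed.

Lemma orient_diag p a : orient p a a = 0.
Proof. by rewrite /orient subrr. Qed.

(** Cauchy-Schwarz on each base: [spread y a b] is a signed sum of at most [m] values of [y]. The
    factor 2 counts the two orders of a base. *)
Lemma spread_sqr_le (m : R) y : 
  (forall a b, a \in Q -> b \in Q -> a != b -> fiber a b <= m) ->
  \sum_(a in Q) \sum_(b in Q) spread y a b ^+ 2 <= 2 * m * dot y y.
Proof.
move=> fm.
have -> : 2 * m * dot y y = \sum_(a in Q) \sum_(b in Q) 
    m * \sum_(v in P) (y v * orient (r v) a b) ^+ 2.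
  under eq_bigr => a _.
    rewrite -mulr_sumr exchange_big /=.
  over.
  rewrite -mulr_sumr exchange_big [2 * m]mulrC -mulrA mulr_sumr; congr (_ * _).
  apply: eq_bigr => v vP; have [? ?] := rQ vP.
  under eq_bigr => a _.
    under eq_bigr => b _ do rewrite exprMn.
    rewrite -mulr_sumr.
  over.
  by rewrite -mulr_sumr sum_orient_sqr ?r12 // mulrC expr2.
apply: ler_sum => a aQ; apply: ler_sum => b bQ.
have [->|ab] := eqVneq a b.
  rewrite [spread _ _ _]big1 ?expr0n; last by move=> v _; rewrite orient_diag mulr0.
  by rewrite big1 ?mulr0 // => v _; rewrite orient_diag mulr0 expr0n.
apply: (@le_trans _ _ (fiber a b * \sum_(v in P) (y v * orient (r v) a b) ^+ 2)); last first.
  by rewrite ler_wpM2r ?fm // sumr_ge0 // => v _; apply: sqr_ge0.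
(* Since [orient] takes only the values -1, 0 and 1, its cube is itself, and [spread] becomes a
   pairing with the indicator of the fibre. *)
have -> : spread y a b
  = dot (fun v => orient (r v) a b ^+ 2) (fun v => y v * orient (r v) a b).
  apply: eq_bigr => v vP; rewrite -[in LHS](orient_cube a b (r12 vP)); ring.
apply: le_trans (dot_sqr_le _ _) _; rewrite ler_wpM2r //.
  by apply: sumr_ge0 => v _; rewrite -expr2 sqr_ge0.
apply: ler_sum => v vP; rewrite -exprD.
by rewrite (_ : 2 + 2 = 4)%N // exprS (orient_cube a b (r12 vP)) -expr2.
Qed.

Lemma dotZDr (a b : R) (u y1 y2 : V -> R) :
  dot u (fun v => a * y1 v + b * y2 v) = a * dot u y1 + b * dot u y2.
Proof.
rewrite /dot !mulr_sumr -big_split; apply: eq_bigr => v _ /=; ring.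
Qed.

Lemma dot_ge0 y : 0 <= dot y y.
Proof. by apply: sumr_ge0 => v _; rewrite -expr2 sqr_ge0. Qed.

(** The trace bound is applied to orthogonal vectors with Rayleigh quotients at least mu1 (mu + |Q|
    - 2) and mu (mu + |Q| - 2); dividing by mu + |Q| - 2 > 0 gives the claim. *)
Lemma pform_sum_le (mu1 mu : R) (y1 y2 : V -> R) :
  0 < mu -> mu <= mu1 -> 2 <= #|Q|%:R :> R ->
  (forall a b, dot (fun v => a * y1 v + b * y2 v) (fun v => a * y1 v + b * y2 v) = 0 ->
     a = 0 /\ b = 0) ->
  (forall a b, mu * (mu + #|Q|%:R - 2)
      * dot (fun v => a * y1 v + b * y2 v) (fun v => a * y1 v + b * y2 v)
      <= pform mu (fun v => a * y1 v + b * y2 v)) ->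
  mu1 * (mu1 + #|Q|%:R - 2) * dot y1 y1 <= pform mu1 y1 ->
  mu1 + mu <= #|P|%:R.
Proof.
move=> mu0 le_mu q2 indep form form1.
set z := fun a b v => a * y1 v + b * y2 v in indep form.
have D0 : 0 < mu + #|Q|%:R - 2 by lra.
have y1_gt0 : 0 < dot y1 y1.
  rewrite lt0r dot_ge0 andbT; apply/eqP => y10.
  have [|/eqP] := indep 1 0; last by rewrite oner_eq0.
  by rewrite -[RHS]y10; apply: eq_bigr => v _; rewrite mul1r mul0r addr0.
have [u1 u1_gt0 u1form] : exists2 u1, 0 < dot u1 u1
    & mu1 * (mu + #|Q|%:R - 2) * dot u1 u1 <= pform mu u1.
  (* If some base carries more than [mu1] pendants, the signed indicator of its fibre is the first
     test vector. *)
  have [/existsP[a /existsP[b /and4P[aQ bQ ab fab]]]|] := boolP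
    [exists a, exists b, [&& a \in Q, b \in Q, a != b & mu1 < fiber a b]].
    exists (fun v => orient (r v) a b).
      by rewrite dot_fiber (lt_trans _ fab) // (lt_le_trans mu0).
    rewrite dot_fiber pform_fiber // expr2 mulrAC ler_wpM2r ?(ltW D0) //.
    by rewrite ler_wpM2r ?(ltW fab) // ltW // (lt_trans _ fab) // (lt_le_trans mu0).
  (* Otherwise [y1] itself works: lowering the parameter from [mu1] to [mu] costs at most mu1 (mu1 -
     mu) |y1|^2, exactly what is lost on the left-hand side. *)
  move=> /existsPn nofib; exists y1 => //.
  have fm a b : a \in Q -> b \in Q -> a != b -> fiber a b <= mu1.
    move=> aQ bQ ab; have /existsPn/(_ b) := nofib a.
    by rewrite aQ bQ ab /= -leNgt.
  have := spread_sqr_le y1 fm; rewrite (pform_shift mu) in form1.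
  move=> lepf.
  have : (mu1 - mu) / 2 * (\sum_(a in Q) \sum_(b in Q) spread y1 a b ^+ 2)
     <= (mu1 - mu) / 2 * (2 * mu1 * dot y1 y1) by rewrite ler_wpM2l //; lra.
  move: form1; move: (dot y1 y1) (\sum_(a in Q) _) (pform mu y1) => N S F.
  set q := #|Q|%:R.
  have -> : (mu1 - mu) / 2 * (2 * mu1 * N) = mu1 * (mu1 - mu) * N by field.
  have -> : mu1 * (mu + q - 2) * N = mu1 * (mu1 + q - 2) * N - mu1 * (mu1 - mu) * N by ring.
  lra.
(* A two-dimensional span contains a nonzero vector orthogonal to [u1]. *)
have [a [b [u2_gt0 u12]]] : exists a b, 0 < dot (z a b) (z a b) /\ dot u1 (z a b) = 0.
  have gt0 a b : (a, b) != (0, 0) -> 0 < dot (z a b) (z a b).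
    move=> ab; rewrite lt0r dot_ge0 andbT; apply: contraNneq ab => z0.
    by have [-> ->] := indep a b z0.
  have [e1|ne1] := eqVneq (dot u1 y1) 0.
    exists 1, 0; split; first by rewrite gt0 // xpair_eqE oner_eq0.
    by rewrite /z dotZDr e1; ring.
  exists (dot u1 y2), (- dot u1 y1); split; last by rewrite /z dotZDr; ring.
  by rewrite gt0 // xpair_eqE oppr_eq0 (negPf ne1) andbF.
have := pform_trace (ltW mu0) u1_gt0 u2_gt0 u12.
have f1 : mu1 * (mu + #|Q|%:R - 2) <= pform mu u1 / dot u1 u1.
  by rewrite ler_pdivlMr.
have f2 : mu * (mu + #|Q|%:R - 2) <= pform mu (z a b) / dot (z a b) (z a b).
  by rewrite ler_pdivlMr //; exact: form.
move=> tr; rewrite -(ler_pM2r D0); apply: le_trans tr.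
by rewrite mulrDl lerD.
Qed.

End Pendants.

(** * The two largest eigenvalues of a system of triples *)

Section TripleSystem.
Variables (R : realFieldType) (V : finType) (tau : V -> V -> V -> bool).
Hypothesis tau12 : forall u v w, tau v u w = tau u v w.
Hypothesis tau23 : forall u v w, tau u w v = tau u v w.
Hypothesis tau_irr : forall u w, tau u u w = false.
Implicit Types (Phi Psi : V -> V -> V -> R) (l : R).

Definition covered : {set V} := [set v | [exists a, exists b, tau v a b]].

(** Of two distinct triples through [v], the second has a vertex outside the first; by the symmetry
    of [tau] it can be listed as [c]. *)
Definition shared : {set V} := [set v | [exists a, exists b, exists c, exists d,
  [&& tau v a b, tau v c d, c != a & c != b]]].

Definition chain Phi := alternating Phi /\ forall u v w, ~~ tau u v w -> Phi u v w = 0.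

Definition eigenchain l Phi :=
  chain Phi /\ forall u v w, tau u v w -> cobd (bd Phi) u v w = l * Phi u v w.

Definition sqnorm Phi := sum3 (fun u v w => Phi u v w ^+ 2).

Lemma coveredP v a b : tau v a b -> v \in covered.
Proof. by move=> t; rewrite inE; apply/existsP; exists a; apply/existsP; exists b. Qed.

Lemma sharedP v a b c d : tau v a b -> tau v c d -> c != a -> c != b -> v \in shared.
Proof.
move=> t1 t2 ca cb; rewrite inE; apply/existsP; exists a; apply/existsP; exists b.
by apply/existsP; exists c; apply/existsP; exists d; rewrite t1 t2 ca cb.
Qed.

Lemma shared_covered : shared \subset covered.
Proof.
apply/subsetP => v; rewrite !inE => /existsP[a /existsP[b /existsP[c /existsP[d]]]].
by case/and4P=> t _ _ _; apply/existsP; exists a; apply/existsP; exists b.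
Qed.

Lemma tau_neq u v w : tau u v w -> [/\ u != v, v != w & u != w].
Proof.
move=> t; split; apply: contraTneq t => ->; first by rewrite tau_irr.
  by rewrite -tau12 -tau23 tau_irr.
by rewrite -tau23 tau_irr.
Qed.

Lemma unshared_unique v a b c d : v \notin shared -> tau v a b -> tau v c d ->
  (c, d) = (a, b) \/ (c, d) = (b, a).
Proof.
move=> vS t1 t2; have [_ cd _] := tau_neq t2.
have in2 x y : tau v x y -> (x == a) || (x == b).
  by move=> t; apply: contraNT vS; rewrite negb_or => /andP[]; apply: sharedP t1 t.
have t3 : tau v d c by rewrite tau23.
case/orP: (in2 _ _ t2) (in2 _ _ t3) cd => /eqP-> /orP[] /eqP->; rewrite ?eqxx //.
  by left.
by right.
Qed.

Lemma chain_neq0 Phi u v w : chain Phi -> Phi u v w != 0 -> tau u v w.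
Proof. by case=> _ Phi0; apply: contraR => t; rewrite Phi0. Qed.

Lemma chain_covered Phi : chain Phi -> supported covered Phi.
Proof.
move=> cPhi u v w uW; apply/eqP; apply: contraNT uW => /(chain_neq0 cPhi).
exact: coveredP.
Qed.

Lemma bd_unshared Phi u v w : chain Phi -> u \notin shared -> tau u v w ->
  bd Phi u v = Phi u v w.
Proof.
move=> cPhi uS t; rewrite /bd (bigD1 w) //= big1 ?addr0 // => x xw.
apply/eqP; apply: contraNT xw => /(chain_neq0 cPhi) t'.
case: (unshared_unique uS t t') => [[->] //|[vw _]].
by have [_] := tau_neq t; rewrite vw eqxx.
Qed.

(** Adjointness turns the eigenvalue equation into an identity of bilinear forms, with an arbitrary
    chain [Psi] as test function. *)
Lemma eigenchain_energy l Phi Psi : eigenchain l Phi -> chain Psi ->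
  3 * (\sum_u \sum_v bd Psi u v * bd Phi u v)
    = l * sum3 (fun u v w => Psi u v w * Phi u v w).
Proof.
move=> [_ ePhi] [aPsi Psi0]; rewrite bd_adj // -sum3Z; apply: eq_sum3 => u v w.
have [t|nt] := boolP (tau u v w); first by rewrite ePhi //; ring.
by rewrite Psi0 //; ring.
Qed.

Lemma sqnorm_ge0 Phi : 0 <= sqnorm Phi.
Proof. by apply: sum3_ge0 => *; apply: sqr_ge0. Qed.

Lemma sqnorm_gt0 Phi u v w : Phi u v w != 0 -> 0 < sqnorm Phi.
Proof.
move=> nz; rewrite lt0r sqnorm_ge0 andbT; apply: contraNneq nz => n0.
by rewrite (sum3_sqr_eq0 n0).
Qed.

Lemma eigenchain_le_supp l Phi (S : {set V}) u v w : eigenchain l Phi ->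
  Phi u v w != 0 -> supported S Phi -> l <= #|S|%:R.
Proof.
move=> ePhi nz sPhi; have [[aPhi _] _] := ePhi.
have := bd_sqr_le aPhi sPhi.
have -> : \sum_u \sum_v bd Phi u v ^+ 2 = \sum_u \sum_v bd Phi u v * bd Phi u v.
  by apply: eq_bigr => x _; apply: eq_bigr => y _; rewrite expr2.
rewrite (eigenchain_energy ePhi ePhi.1).
rewrite (@eq_sum3 _ _ (fun u v w => Phi u v w * Phi u v w)
  (fun u v w => Phi u v w ^+ 2)); last by move=> *; rewrite expr2.
by rewrite ler_pM2r // (sqnorm_gt0 nz).
Qed.

(** Each of the three edges contains [u] or [v] and so lies in this triple only; up to orientation
    the boundary there is [Phi u v w], and the coboundary adds the three equal values. *)
Lemma eigenchain_isolated l Phi u v w : eigenchain l Phi ->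
  u \notin shared -> v \notin shared -> Phi u v w != 0 -> l = 3.
Proof.
move=> [cPhi ePhi] uS vS nz; have t := chain_neq0 cPhi nz.
have [[a12 a23] _] := cPhi.
have bd_vw : bd Phi v w = Phi u v w.
  rewrite (bd_unshared cPhi vS (w := u)); last by rewrite tau23 tau12.
  by rewrite alternating_rot.
have bd_wu : bd Phi w u = Phi u v w.
  rewrite bd_anti // (bd_unshared cPhi uS (w := v)); last by rewrite tau23.
  by rewrite a23 opprK.
have := ePhi _ _ _ t; rewrite /cobd (bd_unshared cPhi uS t) bd_vw bd_wu => e.
by apply: (mulIf nz); rewrite -e; ring.
Qed.

(** The base opposite [v], with an orientation fixed by choice; (v, v) is the default when no triple
    contains [v]. *)
Definition apex_pair v : V * V := odflt (v, v) [pick p | tau v p.1 p.2].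

Definition pendants : {set V} := [set v | [&& v \notin shared,
  tau v (apex_pair v).1 (apex_pair v).2, (apex_pair v).1 \in shared
  & (apex_pair v).2 \in shared]].

Lemma apex_pairP v a b : tau v a b -> tau v (apex_pair v).1 (apex_pair v).2.
Proof.
by move=> t; rewrite /apex_pair; case: pickP => //= /(_ (a, b)); rewrite t.
Qed.

Lemma pendants_shared : [disjoint pendants & shared].
Proof.
rewrite -setI_eq0; apply/eqP/setP => v; rewrite !in_setI in_set0.
by apply/negP => /andP[]; rewrite inE => /andP[/negP].
Qed.

Lemma card_pendants : (#|pendants| + #|shared| <= #|covered|)%N.
Proof.
rewrite -cardsUI (disjoint_setI0 pendants_shared) cards0 addn0.
apply: subset_leq_card; rewrite subUset shared_covered andbT.
by apply/subsetP => v; rewrite inE => /and4P[_ /coveredP].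
Qed.

Lemma pendantsP v a b : v \notin shared -> tau v a b -> a \in shared -> b \in shared ->
  v \in pendants.
Proof.
move=> vS t aS bS; rewrite inE vS (apex_pairP t) /=.
case: (unshared_unique vS t (apex_pairP t)).
  by case: apex_pair => x y [-> ->] /=; rewrite aS.
by case: apex_pair => x y [-> ->] /=; rewrite aS bS.
Qed.

Lemma apex_pair_shared v : v \in pendants ->
  (apex_pair v).1 \in shared /\ (apex_pair v).2 \in shared.
Proof. by rewrite inE => /and4P[]. Qed.

Lemma apex_pair_neq v : v \in pendants -> (apex_pair v).1 != (apex_pair v).2.
Proof. by rewrite inE => /and4P[_ /tau_neq[]]. Qed.

Definition apex Phi v := Phi v (apex_pair v).1 (apex_pair v).2.

(** A pendant lies in a single triple, so one number, the y_v of the overview, determines [Phi] at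
    [v]. *)
Lemma pendantE Phi v a b : chain Phi -> v \in pendants ->
  Phi v a b = apex Phi v * orient R (apex_pair v) a b.
Proof.
move=> cPhi vP; have ne := apex_pair_neq vP.
move: vP; rewrite inE /apex => /and4P[vS t _ _]; move: t ne.
case: (apex_pair v) => c d /= t cd.
have [[a12 a23] Phi0] := cPhi; rewrite /orient.
have [tab|ntab] := boolP (tau v a b).
  case: (unshared_unique vS t tab) => -[-> ->]; rewrite !xpair_eqE !eqxx.
    by rewrite (negPf cd) subr0 mulr1.
  by rewrite [d == c]eq_sym (negPf cd) sub0r mulrN1 a23.
have /negPf -> : (c, d) != (a, b) by apply: contraNneq ntab => -[<- <-].
have /negPf -> : (c, d) != (b, a) by apply: contraNneq ntab => -[<- <-]; rewrite tau23.
by rewrite Phi0 // subrr mulr0.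
Qed.

(** The support contains no isolated triple; by [eigenchain_isolated] this holds for every
    eigenchain whose eigenvalue is not 3. *)
Definition attached Phi :=
  forall u v w, u \notin shared -> v \notin shared -> Phi u v w = 0.

Definition core Phi u v w :=
  if [&& u \in shared, v \in shared & w \in shared] then Phi u v w else 0.

Lemma core_alternating Phi : alternating Phi -> alternating (core Phi).
Proof.
case=> a12 a23; split=> u v w; rewrite /core.
  by rewrite andbCA; case: ifP; rewrite ?oppr0.
by rewrite [(w \in _) && _]andbC; case: ifP; rewrite ?oppr0.
Qed.

Lemma core_supported Phi : supported shared (core Phi).
Proof. by move=> u v w uS; rewrite /core (negPf uS). Qed.

Lemma sum_apex_row Phi u : chain Phi -> u \in pendants ->
  \sum_v bd Phi u v ^+ 2 = 2 * apex Phi u ^+ 2.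
Proof.
move=> cPhi uP.
rewrite -(@sum_orient_row_sqr R V setT (apex_pair u)) ?inE ?apex_pair_neq // mulr_suml.
apply: eq_big => [v|v _]; first by rewrite inE.
rewrite -exprMn mulr_suml; congr (_ ^+ 2).
by apply: eq_big => [w|w _]; rewrite ?inE // (pendantE _ _ cPhi uP) mulrC.
Qed.

Lemma sum_apex Phi u : chain Phi -> u \in pendants ->
  \sum_v \sum_w Phi u v w ^+ 2 = 2 * apex Phi u ^+ 2.
Proof.
move=> cPhi uP.
rewrite -(@sum_orient_sqr R V setT (apex_pair u)) ?inE ?apex_pair_neq // mulr_suml.
apply: eq_big => [v|v _]; first by rewrite inE.
rewrite mulr_suml; apply: eq_big => [w|w _]; rewrite ?inE //.
by rewrite (pendantE _ _ cPhi uP) exprMn mulrC.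
Qed.

Lemma attached_pendant Phi u v w : chain Phi -> attached Phi ->
  u \notin shared -> Phi u v w != 0 ->
  [/\ u \in pendants, v \in shared & w \in shared].
Proof.
move=> cPhi att uS nz; have [[a12 a23] _] := cPhi.
have vS : v \in shared by apply: contraNT nz => vS; rewrite att.
have wS : w \in shared by apply: contraNT nz => wS; rewrite a23 att ?oppr0.
by split=> //; apply: pendantsP (chain_neq0 cPhi nz) vS wS.
Qed.

Lemma pendants_notin u : u \in pendants -> (u \in shared) = false.
Proof. by rewrite inE => /andP[/negPf]. Qed.

Local Notation Y := (fun Phi => dot pendants (apex Phi) (apex Phi)).

(** A triple in the support lies inside [shared] or has exactly one pendant vertex; the latter
    occurs in six orders. *)
Lemma sqnorm_split Phi : chain Phi -> attached Phi ->
  sqnorm Phi = sqnorm (core Phi) + 6 * Y Phi.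
Proof.
move=> cPhi att; have aPhi := cPhi.1.
(* [g] collects the triples whose pendant comes first; its two rotations collect the other
   positions. *)
pose g u v w := if u \in pendants then Phi u v w ^+ 2 else 0.
have -> : sqnorm Phi = sum3 (fun u v w => core Phi u v w ^+ 2
    + (g u v w + (g v w u + g w u v))).
  apply: eq_sum3 => u v w; rewrite /g /core.
  rewrite (alternating_rot v w u aPhi) (alternating_rot u v w aPhi).
  have [->|nz] := eqVneq (Phi u v w) 0; first by rewrite if_same !expr0n /= !if_same !addr0.
  have nz2 : Phi v w u != 0 by rewrite (alternating_rot u v w aPhi).
  have nz3 : Phi w u v != 0 by rewrite (alternating_rot v w u aPhi).
  have [uS|uS] /= := boolP (u \in shared); last first.
    have [uP vS wS] := attached_pendant cPhi att uS nz.
    have [vP wP] : v \notin pendants /\ w \notin pendants.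
      by split; apply/negP => /pendants_notin; rewrite ?vS ?wS.
    by rewrite uP (negPf vP) (negPf wP) expr0n /= add0r !addr0.
  have uP : u \notin pendants by apply/negP => /pendants_notin; rewrite uS.
  have [vS|vS] /= := boolP (v \in shared); last first.
    have [vP wS _] := attached_pendant cPhi att vS nz2.
    have wP : w \notin pendants by apply/negP => /pendants_notin; rewrite wS.
    by rewrite vP (negPf uP) (negPf wP) expr0n /= !add0r !addr0.
  have vP : v \notin pendants by apply/negP => /pendants_notin; rewrite vS.
  have [wS|wS] /= := boolP (w \in shared); last first.
    have [wP _ _] := attached_pendant cPhi att wS nz3.
    by rewrite wP (negPf uP) (negPf vP) expr0n /= !add0r.
  have wP : w \notin pendants by apply/negP => /pendants_notin; rewrite wS.
  by rewrite (negPf uP) (negPf vP) (negPf wP) !addr0.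
rewrite !sum3D (sum3_rot g) -(sum3_rot (fun u v w => g w u v)).
rewrite -[sum3 (fun u v w => g u v w)]/(sum3 g).
have -> : sum3 g = 2 * Y Phi.
  rewrite /dot mulr_sumr /sum3 [LHS](bigID (mem pendants)) /= [X in _ + X]big1 ?addr0; last first.
    by move=> u uP; apply: big1 => v _; apply: big1 => w _; rewrite /g (negPf uP).
  apply: eq_bigr => u uP; rewrite -expr2 -(sum_apex cPhi uP).
  by apply: eq_bigr => v _; apply: eq_bigr => w _; rewrite /g uP.
rewrite /sqnorm; ring.
Qed.

Lemma spread_apex Phi u v : chain Phi ->
  spread pendants apex_pair (apex Phi) u v = \sum_(x in pendants) Phi u v x.
Proof.
move=> cPhi; apply: eq_bigr => x xP; rewrite -(pendantE _ _ cPhi xP).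
by rewrite (alternating_rot x u v cPhi.1) .
Qed.

Lemma bd_split Phi u v : chain Phi -> attached Phi -> u \in shared -> v \in shared ->
  bd Phi u v = bd (core Phi) u v + spread pendants apex_pair (apex Phi) u v.
Proof.
move=> cPhi att uS vS; rewrite spread_apex // /bd [X in _ + X]big_mkcond -big_split.
apply: eq_bigr => x _; rewrite /core uS vS /=.
have [xS|xS] /= := boolP (x \in shared).
  case: ifP => [/pendants_notin|_]; first by rewrite xS.
  by rewrite addr0.
rewrite add0r; case: ifPn => // xP; apply/eqP; apply: contraNT xP => nz.
have nz' : Phi x u v != 0 by rewrite -(alternating_rot x u v cPhi.1).
by have [] := attached_pendant cPhi att xS nz'.
Qed.

Lemma spread_notin (y : V -> R) u v : u \notin shared ->
  spread pendants apex_pair y u v = 0.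
Proof.
move=> uS; apply: big1 => x xP; have [r1 r2] := apex_pair_shared xP.
rewrite /orient; case: (apex_pair x) r1 r2 => c d /= cS dS; rewrite !xpair_eqE.
have [cu|_] := eqVneq c u; first by rewrite -cu cS in uS.
have [du|_] := eqVneq d u; first by rewrite -du dS in uS.
by rewrite andbF subrr mulr0.
Qed.

(** Besides the pairs inside [shared], the boundary lives on the two edges from each pendant to its
    base; each carries y_v up to sign and is counted in two orders, whence the 4. *)
Lemma bd_sqr_split Phi : chain Phi -> attached Phi ->
  \sum_u \sum_v bd Phi u v ^+ 2
  = \sum_u \sum_v (bd (core Phi) u v + spread pendants apex_pair (apex Phi) u v) ^+ 2
    + 4 * Y Phi.
Proof.
move=> cPhi att; have aPhi := cPhi.1; have aC := core_alternating aPhi.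
have sC := @core_supported Phi.
pose g u v := if u \in pendants then bd Phi u v ^+ 2 else 0.
have bd0 u v : u \notin shared -> u \notin pendants -> bd Phi u v = 0.
  move=> uS uP; apply: big1 => w _; apply/eqP; apply: contraNT uP => nz.
  by have [] := attached_pendant cPhi att uS nz.
have bd00 u v : u \notin shared -> v \notin shared -> bd Phi u v = 0.
  by move=> uS vS; apply: big1 => w _; rewrite att.
rewrite (eq_bigr (fun u => \sum_v (bd (core Phi) u v
    + spread pendants apex_pair (apex Phi) u v) ^+ 2 + (\sum_v g u v + \sum_v g v u))); last first.
  move=> u _; rewrite -!big_split; apply: eq_bigr => v _ /=.
  have [uS|uS] := boolP (u \in shared); last first.
    rewrite (bd_supp _ aC sC) // spread_notin // addr0 expr0n add0r /g.
    have [uP|uP] := boolP (u \in pendants); last first.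
      by rewrite bd0 // bd_anti // bd0 // oppr0 expr0n /= if_same addr0.
    case: ifP => [vP|_]; last by rewrite addr0.
    have vS : v \notin shared by rewrite pendants_notin.
    by rewrite bd00 // bd00 // expr0n addr0.
  have uP : u \notin pendants by apply/negP => /pendants_notin; rewrite uS.
  rewrite /g (negPf uP).
  have [vS|vS] := boolP (v \in shared); last first.
    rewrite bd_anti // sqrrN (bd_anti _ _ aC) (bd_supp _ aC sC) // spread_anti spread_notin //.
    rewrite oppr0 addr0 expr0n !add0r.
    by case: ifPn => // vP; rewrite bd0 // expr0n.
  have vP : v \notin pendants by apply/negP => /pendants_notin; rewrite vS.
  by rewrite (negPf vP) !addr0 bd_split.
rewrite big_split big_split /=; congr (_ + _).
rewrite [X in _ + X]exchange_big /=.
have -> : \sum_u \sum_v g u v = 2 * Y Phi.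
  rewrite /dot mulr_sumr [LHS](bigID (mem pendants)) /= [X in _ + X]big1 ?addr0; last first.
    by move=> u uP; apply: big1 => v _; rewrite /g (negPf uP).
  apply: eq_bigr => u uP; rewrite -expr2 -(sum_apex_row cPhi uP).
  by apply: eq_bigr => v _; rewrite /g uP.
ring.
Qed.

(** Elimination of the core X: [bd_sqr_le] bounds its own energy by |Q| |X|^2 and [bd_pairing_le]
    with c = mu = l - |Q| bounds the cross term by mu |X|^2 plus a coboundary term. Together these
    use up exactly l |X|^2. The energy hypothesis is an inequality so that combinations of two
    eigenchains are covered. *)
Lemma pform_ge l Phi : chain Phi -> attached Phi -> #|shared|%:R < l ->
  l * sqnorm Phi <= 3 * (\sum_u \sum_v bd Phi u v ^+ 2) ->
  (l - #|shared|%:R) * (l - 2) * Y Phi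
    <= pform pendants shared apex_pair (l - #|shared|%:R) (apex Phi).
Proof.
move=> cPhi att ql; have aC := core_alternating cPhi.1.
have sC := @core_supported Phi.
rewrite sqnorm_split // bd_sqr_split //.
set w := spread _ _ _.
have anti u v : w v u = - w u v by apply: spread_anti.
set q := #|shared|%:R in ql *; set mu := l - q.
have mu0 : 0 < mu by rewrite subr_gt0.
have le1 := bd_sqr_le aC sC.
have le2 := bd_pairing_le aC sC anti mu0.
rewrite (_ : \sum_u \sum_v (bd (core Phi) u v + w u v) ^+ 2
  = (\sum_u \sum_v bd (core Phi) u v ^+ 2) + (2 * (\sum_u \sum_v bd (core Phi) u v * w u v)
    + \sum_u \sum_v w u v ^+ 2)); last first.
  rewrite mulr_sumr -!big_split; apply: eq_bigr => u _.
  rewrite mulr_sumr -!big_split; apply: eq_bigr => v _ /=; ring.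
have wE : \sum_u \sum_v w u v ^+ 2 = \sum_(u in shared) \sum_(v in shared) w u v ^+ 2.
  rewrite -(@sum_in_supp _ _ shared) => [|u uS].
    apply: eq_bigr => u _; rewrite -(@sum_in_supp _ _ shared) // => v vS.
    by rewrite anti /w spread_notin // oppr0 expr0n.
  by apply: big1 => v _; rewrite /w spread_notin // expr0n.
rewrite wE /pform -/w -/mu; move: le1 le2; rewrite -/(sqnorm _) -/q.
move: (\sum_u \sum_v bd (core Phi) u v ^+ 2) (\sum_u \sum_v bd (core Phi) u v * w u v).
move: (\sum_(u in shared) \sum_(v in shared) w u v ^+ 2) (Y Phi) (sqnorm _).
move: (\sum_(a in shared) _) => C W2 Yv B A X le1 le2 le3.
have {}le3 : 6 * (l - 2) * Yv <= mu^-1 * C + 3 * W2.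
  have lE : l = mu + q by rewrite /mu; ring.
  rewrite lE in le3 *; lra.
have := ler_wpM2l (ltW mu0) le3.
have -> : mu * (mu^-1 * C + 3 * W2) = C + 3 * mu * W2 by field; rewrite gt_eqF.
lra.
Qed.

(** * Combinations of two eigenchains *)

Definition comb a b Phi Psi u v w : R := a * Phi u v w + b * Psi u v w.

Definition independent Phi Psi :=
  forall a b, (forall u v w, comb a b Phi Psi u v w = 0) -> a = 0 /\ b = 0.

Lemma comb_chain a b Phi Psi : chain Phi -> chain Psi -> chain (comb a b Phi Psi).
Proof.
move=> [[a12 a23] Phi0] [[b12 b23] Psi0]; split; last first.
  by move=> u v w t; rewrite /comb Phi0 // Psi0 // !mulr0 addr0.
split=> u v w; rewrite /comb; first by rewrite a12 b12; ring.
by rewrite a23 b23; ring.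
Qed.

Lemma independent_neq0 a b Phi Psi : independent Phi Psi -> (a, b) != (0, 0) ->
  exists u v w, comb a b Phi Psi u v w != 0.
Proof.
move=> ind ab0.
have [/existsP[u /existsP[v /existsP[w nz]]]|/existsPn z] := boolP [exists u, exists v,
  exists w, comb a b Phi Psi u v w != 0]; first by exists u, v, w.
case/negP: ab0; suff [-> ->] : a = 0 /\ b = 0 by [].
apply: ind => u v w; apply/eqP; rewrite -[_ == 0]negbK.
by have /existsPn/(_ v)/existsPn/(_ w) := z u.
Qed.

Lemma tau_set u v w x : tau u v w -> x \in [set u; v; w] ->
  exists p q, tau x p q /\ [set x; p; q] = [set u; v; w].
Proof.
move=> t; rewrite !inE -orbA => /or3P[] /eqP->.
- by exists v, w.
- by exists u, w; split; rewrite 1?tau12 // (setUC [set v]).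
- exists u, v; split; first by rewrite tau12 tau23.
  by rewrite [RHS]setUC -setUA.
Qed.

Lemma card_triple u v w : tau u v w -> #|[set u; v; w]| = 3%N.
Proof.
move=> /tau_neq[uv vw uw].
by rewrite setUC cardsU1 cards2 !inE negb_or eq_sym uw eq_sym vw uv.
Qed.

(** Inclusion-exclusion: the union of the two triples is covered, and their common vertices are
    shared. *)
Lemma two_triples u v w a b c : tau u v w -> tau a b c ->
  [set u; v; w] != [set a; b; c] -> (6 <= #|covered| + #|shared|)%N.
Proof.
move=> t1 t2 ne.
have sub_cov u' v' w' : tau u' v' w' -> [set u'; v'; w'] \subset covered.
  by move=> t; apply/subsetP => x /(tau_set t)[p [q [/coveredP]]].
rewrite -[6%N]/(3 + 3)%N -{1}(card_triple t1) -(card_triple t2) -cardsUI.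
apply: leq_add; apply: subset_leq_card; first by rewrite subUset !sub_cov.
apply/subsetP => x; rewrite in_setI => /andP[x1 x2].
have [p [q [tp e1]]] := tau_set t1 x1; have [r [s [tr e2]]] := tau_set t2 x2.
(* If a vertex of the second triple other than [x] is missing from the first, it witnesses that [x]
   is shared; otherwise the triples coincide. *)
have [rpq|] := boolP ((r \in [set p; q]) && (s \in [set p; q])); last first.
  rewrite negb_and !in_set2 !negb_or => /orP[] /andP[]; first exact: sharedP tp tr.
  by have ts : tau x s r; [rewrite tau23 | apply: sharedP tp ts].
case/negP: ne; rewrite eq_sym eqEcard !card_triple // leqnn andbT -e1 -e2.
case/andP: rpq; rewrite !subUset !sub1set !inE eqxx /=.
by move=> /orP[]-> /orP[]->; rewrite ?orbT.
Qed.

Lemma alternating_perm0 Phi u v w a b c : alternating Phi -> tau a b c ->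
  a \in [set u; v; w] -> b \in [set u; v; w] -> c \in [set u; v; w] ->
  Phi u v w = 0 -> Phi a b c = 0.
Proof.
move=> [a12 a23] /tau_neq[].
rewrite !inE -!orbA => ab bc ac /or3P[] /eqP ea /or3P[] /eqP eb /or3P[] /eqP ec;
  move: ab bc ac; rewrite ea eb ec ?eqxx // => _ _ _ z.
- by rewrite a23 z oppr0.
- by rewrite a12 z oppr0.
- by rewrite a23 a12 z !oppr0.
- by rewrite a12 a23 z !oppr0.
- by rewrite a12 a23 a12 z !oppr0.
Qed.

Lemma independent_card Phi Psi : chain Phi -> chain Psi -> independent Phi Psi ->
  (6 <= #|covered| + #|shared|)%N.
Proof.
move=> cPhi cPsi ind.
have [|u [v [w nz]]] := independent_neq0 ind (a := 1) (b := 0).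
  by rewrite xpair_eqE oner_eq0.
rewrite /comb mul1r mul0r addr0 in nz.
have t := chain_neq0 cPhi nz.
(* This combination vanishes at (u, v, w), so its support supplies a different triple. *)
have [|a [b [c nzc]]] := independent_neq0 ind (a := - Psi u v w) (b := Phi u v w).
  by rewrite xpair_eqE (negPf nz) andbF.
have cC := comb_chain (- Psi u v w) (Phi u v w) cPhi cPsi.
have t' := chain_neq0 cC nzc.
apply: (two_triples t t'); apply: contraNneq nzc => eqs.
by rewrite (alternating_perm0 cC.1 t' (u := u) (v := v) (w := w)) ?eqs ?inE ?eqxx ?orbT //
  /comb; ring.
Qed.

(** When the cross term is evaluated with the eigenvalue [l2], the difference of the two sides is
    (l1 - l2) a^2 |Phi|^2. *)
Lemma comb_energy l1 l2 Phi Psi a b : l2 <= l1 -> eigenchain l1 Phi -> eigenchain l2 Psi ->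
  l2 * sqnorm (comb a b Phi Psi)
    <= 3 * \sum_u \sum_v bd (comb a b Phi Psi) u v ^+ 2.
Proof.
move=> le_l e1 e2.
have -> : 3 * \sum_u \sum_v bd (comb a b Phi Psi) u v ^+ 2
  = a ^+ 2 * (3 * \sum_u \sum_v bd Phi u v * bd Phi u v)
    + (2 * a * b * (3 * \sum_u \sum_v bd Phi u v * bd Psi u v)
       + b ^+ 2 * (3 * \sum_u \sum_v bd Psi u v * bd Psi u v)).
  rewrite !mulr_sumr -!big_split; apply: eq_bigr => u _.
  rewrite !mulr_sumr -!big_split; apply: eq_bigr => v _ /=.
  have -> : bd (comb a b Phi Psi) u v = a * bd Phi u v + b * bd Psi u v.
    by rewrite /bd big_split -!mulr_sumr.
  ring.
rewrite (eigenchain_energy e1 e1.1) (eigenchain_energy e2 e1.1).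
rewrite (eigenchain_energy e2 e2.1).
have -> : sqnorm (comb a b Phi Psi) = a ^+ 2 * sum3 (fun u v w => Phi u v w * Phi u v w)
  + (2 * a * b * sum3 (fun u v w => Phi u v w * Psi u v w)
     + b ^+ 2 * sum3 (fun u v w => Psi u v w * Psi u v w)).
  rewrite -!sum3Z -!sum3D; apply: eq_sum3 => u v w; rewrite /comb; ring.
rewrite -subr_ge0.
set N := sum3 _; set N12 := sum3 _; set N2 := sum3 _.
have N0 : 0 <= N by apply: sum3_ge0 => *; rewrite -expr2 sqr_ge0.
rewrite [leRHS](_ : _ = (l1 - l2) * (a ^+ 2 * N)); last by ring.
by rewrite mulr_ge0 ?subr_ge0 // mulr_ge0 ?sqr_ge0.
Qed.

Lemma attached_card Phi u v w : chain Phi -> attached Phi -> Phi u v w != 0 ->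
  (2 <= #|shared|)%N.
Proof.
move=> cPhi att nz.
have card2 x y : x != y -> x \in shared -> y \in shared -> (2 <= #|shared|)%N.
  move=> xy xS yS; have <- : #|[set x; y]| = 2%N by rewrite cards2 xy.
  by apply: subset_leq_card; rewrite subUset !sub1set xS.
have [uv vw uw] := tau_neq (chain_neq0 cPhi nz).
have [uS|uS] := boolP (u \in shared); last first.
  by have [_] := attached_pendant cPhi att uS nz; apply: card2.
have [vS|vS] := boolP (v \in shared); first exact: card2 uS vS.
have nz' : Phi v w u != 0 by rewrite (alternating_rot u v w cPhi.1).
have [_ wS _] := attached_pendant cPhi att vS nz'.
exact: card2 uS wS.
Qed.

(** Without apex values the chain is supported on [shared], where the energy is at most |Q| < l
    times the squared norm. This makes the apex vectors of independent eigenchains independent. *)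
Lemma attached_apex0 l Phi : chain Phi -> attached Phi -> #|shared|%:R < l ->
  l * sqnorm Phi <= 3 * \sum_u \sum_v bd Phi u v ^+ 2 ->
  Y Phi = 0 -> forall u v w, Phi u v w = 0.
Proof.
move=> cPhi att ql en Y0; apply: sum3_sqr_eq0.
have sPhi : supported shared Phi.
  move=> u v w uS; apply/eqP; apply/contraT => nz.
  have [uP _ _] := attached_pendant cPhi att uS nz.
  have /eqP := psumr_eq0P (fun v _ => sqr_ge0 (apex Phi v) : 0 <= apex Phi v * apex Phi v) Y0 uP.
  rewrite mulf_eq0 orbb => /eqP ap0.
  by rewrite (pendantE _ _ cPhi uP) ap0 mul0r eqxx in nz.
have := le_trans en (bd_sqr_le cPhi.1 sPhi); rewrite -/(sqnorm Phi) => le0.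
have : (l - #|shared|%:R) * sqnorm Phi <= 0 by rewrite mulrBl subr_le0.
rewrite pmulr_rle0 ?subr_gt0 // => le00.
by apply/eqP; rewrite eq_le le00 sqnorm_ge0.
Qed.

Theorem eigenchain_le l Phi u v w : eigenchain l Phi -> Phi u v w != 0 ->
  l <= #|covered|%:R.
Proof.
by move=> e nz; exact: (eigenchain_le_supp e nz (chain_covered e.1)).
Qed.

(** The only triple through [u] or [v] is the isolated one, where [Phi] vanishes; so [Phi] is
    supported on two vertices fewer. *)
Lemma eigenchain_detached_le l Phi Psi u v w x y z : eigenchain l Phi ->
  attached Phi -> Phi x y z != 0 ->
  chain Psi -> u \notin shared -> v \notin shared -> Psi u v w != 0 ->
  l + 2 <= #|covered|%:R.
Proof.
move=> e att nz cPsi uS vS nzw; have cPhi := e.1.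
have t := chain_neq0 cPsi nzw; have [uv _ _] := tau_neq t.
have P0 u' v' : tau u' v' w -> u' \notin shared -> v' \notin shared ->
    forall p q, Phi u' p q = 0.
  move=> t' uS' vS' p q; have [//|/(chain_neq0 cPhi) t2] := eqVneq (Phi u' p q) 0.
  have [[_ a23] _] := cPhi.
  case: (unshared_unique uS' t' t2) => -[-> ->]; first by rewrite att.
  by rewrite a23 att // oppr0.
have sup : supported (covered :\: [set u; v]) Phi.
  move=> a b c; rewrite !inE negb_and negbK => /orP[/orP[]/eqP->|].
  - exact: P0 t uS vS _ _.
  - by apply: P0 vS uS _ _; rewrite tau12.
  by move=> aC; apply: (chain_covered cPhi); rewrite inE.
have := eigenchain_le_supp e nz sup.
have uvC : [set u; v] \subset covered.
  by rewrite subUset !sub1set (coveredP t) (@coveredP v u w) // tau12.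
have -> : #|covered :\: [set u; v]|%:R = #|covered|%:R - 2 :> R.
  rewrite cardsD (setIidPr uvC) cards2 uv natrB //.
  by have := subset_leq_card uvC; rewrite cards2 uv.
by rewrite lerBrDr.
Qed.

Theorem eigenchain2_le l1 l2 Phi1 Phi2 : eigenchain l1 Phi1 -> eigenchain l2 Phi2 ->
  independent Phi1 Phi2 -> l1 + l2 <= #|covered|%:R + #|shared|%:R.
Proof.
wlog le21 : l1 l2 Phi1 Phi2 / l2 <= l1 => [wl e1 e2 ind|e1 e2 ind].
  have [?|/ltW ?] := leP l2 l1; first exact: wl e1 e2 ind.
  rewrite addrC; apply: (wl _ _ Phi2 Phi1) => // a b z.
  by have [] := ind b a (fun u v w => etrans (addrC _ _) (z u v w)).
(* This settles the case l1 <= 3; beyond it the support of [Phi1] avoids isolated triples. *)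
have c6 : 6 <= #|covered|%:R + #|shared|%:R :> R.
  by rewrite -natrD ler_nat; apply: independent_card e1.1 e2.1 ind.
have [le13|lt13] := leP l1 3; first by apply: le_trans c6; lra.
have [|x [y [z nz]]] := independent_neq0 ind (a := 1) (b := 0).
  by rewrite xpair_eqE oner_eq0.
rewrite /comb mul1r mul0r addr0 in nz.
have l1n := eigenchain_le e1 nz.
have [l2q|ql2] := leP l2 #|shared|%:R; first by apply: lerD.
have att1 : attached Phi1.
  move=> u v w uS vS; apply/eqP; apply/contraT => /(eigenchain_isolated e1 uS vS) l13.
  by rewrite l13 ltxx in lt13.
have q2 : 2 <= #|shared|%:R :> R.
  by rewrite ler_nat; apply: attached_card e1.1 att1 nz.
have [/existsP[u /existsP[v /existsP[w /and3P[uS vS nzw]]]]|noiso] := boolP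
  [exists u, exists v, exists w, [&& u \notin shared, v \notin shared & Phi2 u v w != 0]].
  (* Here l2 = 3 and l1 <= |W| - 2, so l1 + l2 <= |W| + 1, and |Q| >= 2. *)
  have l23 := eigenchain_isolated e2 uS vS nzw.
  have := eigenchain_detached_le e1 att1 nz e2.1 uS vS nzw.
  lra.
have att2 : attached Phi2.
  move=> u v w uS vS; have /existsPn/(_ u)/existsPn/(_ v)/existsPn/(_ w) := noiso.
  by rewrite uS vS /= negbK => /eqP.
have attc a b : attached (comb a b Phi1 Phi2).
  by move=> u v w uS vS; rewrite /comb att1 // att2 // !mulr0 addr0.
have cc a b := comb_chain a b e1.1 e2.1.
have en a b := comb_energy a b le21 e1 e2.
have mu0 : 0 < l2 - #|shared|%:R by rewrite subr_gt0.
have mule : l2 - #|shared|%:R <= l1 - #|shared|%:R by rewrite lerB.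
have := @pform_sum_le R V pendants shared apex_pair apex_pair_shared apex_pair_neq
  (l1 - #|shared|%:R) _ (apex Phi1) (apex Phi2) mu0 mule q2.
have card_le : #|pendants|%:R + #|shared|%:R <= #|covered|%:R :> R.
  by rewrite -natrD ler_nat card_pendants.
move=> H; suff : (l1 - #|shared|%:R) + (l2 - #|shared|%:R) <= #|pendants|%:R by lra.
apply: H.
- move=> a b Y0; apply: ind.
  exact: (attached_apex0 (cc a b) (attc a b) ql2 (en a b) Y0).
- move=> a b; have := pform_ge (cc a b) (attc a b) ql2 (en a b).
  by rewrite subrK.
- have ql1 : #|shared|%:R < l1 by apply: lt_le_trans le21.
  rewrite subrK; apply: pform_ge e1.1 att1 ql1 _.
  rewrite [leRHS](_ : _ = l1 * sqnorm Phi1) //.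
  rewrite [sqnorm _](@eq_sum3 _ _ _ (fun u v w => Phi1 u v w * Phi1 u v w)); last first.
    by move=> *; rewrite expr2.
  by rewrite -(eigenchain_energy e1 e1.1); congr (_ * _).
Qed.

End TripleSystem.

(** * Triangles of a graph, and edges via the cone *)

Section Graph.
Variables (R : realType) (G : sgraph).
Local Notation L2E := (L2E R G).

Definition lin_indep (vT : vectType R) (x y : vT) :=
  forall a b : R, a *: x + b *: y = 0 -> a = 0 /\ b = 0.

Definition tri (u v w : G) := is_triangle (u, v, w).

Lemma tri12 u v w : tri v u w = tri u v w. Proof. exact: is_triangle12. Qed.

Lemma tri23 u v w : tri u w v = tri u v w. Proof. exact: is_triangle23. Qed.

Lemma tri_irr u w : tri u u w = false.
Proof.
rewrite /tri /is_triangle inE /= setUid.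
by apply/negP => /andP[]; rewrite cards2; case: (u != w).
Qed.

Lemma card_covered_tri : (#|covered tri| <= D_top G 1)%N.
Proof.
apply/subset_leq_card/subsetP => v; rewrite !inE => /existsP[a /existsP[b t]].
apply/card_gt0P; exists [set v; a; b]; rewrite !inE eqxx /= andbT.
by move: t; rewrite /tri /is_triangle inE.
Qed.

Lemma card_shared_tri : (#|shared tri| <= D_top G 2)%N.
Proof.
apply/subset_leq_card/subsetP => v; rewrite /shared in_set.
case/existsP=> a /existsP[b /existsP[c /existsP[d /and4P[t1 t2 ca cb]]]].
have [vc _ _] := tau_neq tri12 tri23 tri_irr t2.
rewrite in_set; have <- : #|[set [set v; a; b]; [set v; c; d]]| = 2%N.
  rewrite cards2; suff -> : [set v; a; b] != [set v; c; d] by [].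
  apply/eqP => /setP/(_ c); rewrite !inE eqxx orbT /=.
  by rewrite eq_sym (negPf vc) (negPf ca) (negPf cb).
apply: subset_leq_card; rewrite subUset !sub1set !in_set !inE eqxx /= !andbT.
by move: t1 t2; rewrite /tri /is_triangle !inE => -> ->.
Qed.

Definition curl_chain (X : L2E) (u v w : G) : R := vsval (curl X) (u, v, w).

Lemma curl_chain_chain X : chain tri (curl_chain X).
Proof.
have := subvsP (curl X); rewrite !memv_cap -andbA => /and3P[/altspaceP P12 _ /altspaceP P23].
have supp u v w : ~~ tri u v w -> curl_chain X u v w = 0.
  by rewrite /curl_chain /tri P12 => /negPf ->.
split=> //; split=> u v w.
  have [t|nt] := boolP (tri u v w); last by rewrite !supp ?oppr0 // tri12.
  by rewrite /curl_chain P12 /= (tri12 u v w : is_triangle _ = _) /= -/(tri u v w) t.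
have [t|nt] := boolP (tri u v w); last by rewrite !supp ?oppr0 // tri23.
by rewrite /curl_chain P23 /= (tri23 u v w : is_triangle _ = _) /= -/(tri u v w) t.
Qed.

Lemma tri_adj u v w : tri u v w -> adj u v.
Proof.
move=> t; have [uv _ _] := tau_neq tri12 tri23 tri_irr t.
move: t; rewrite /tri /is_triangle inE => /andP[_ /forall_inP/(_ u)].
rewrite !inE eqxx => /(_ isT)/forall_inP/(_ v).
by rewrite !inE eqxx orbT => /(_ isT)/implyP; apply.
Qed.

Lemma curl_eigenchain l X : curl_adj_curl R G X = l *: X ->
  eigenchain tri l (curl_chain X).
Proof.
move=> eX; have cX := curl_chain_chain X; split=> // u v w t.
have bdE a b : bd (curl_chain X) a b = vsval (curl_adj (curl X)) (a, b).
  rewrite /bd ffunE /=; case: ifPn => // nab; apply: big1 => c _.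
  by apply: cX.2; apply: contra nab; apply: tri_adj.
have {}eX : curl_adj (curl X) = l *: X by rewrite -eX comp_lfunE !lfunE.
rewrite /cobd !bdE eX /curl_chain /= !ffunE -/(tri u v w) t.
by rewrite !mulrDr.
Qed.

Lemma curl_chain_comb a b X Y u v w :
  comb a b (curl_chain X) (curl_chain Y) u v w = curl_chain (a *: X + b *: Y) u v w.
Proof.
rewrite /curl_chain /comb (_ : curl (a *: X + b *: Y) = a *: curl X + b *: curl Y).
  by move: (curl X) (curl Y) => Phi Psi; rewrite linearD !linearZ !ffunE.
by rewrite linearD !linearZ.
Qed.

Lemma curl_chain_eq0 X : (forall u v w, curl_chain X u v w = 0) -> curl X = 0.
Proof. by move=> X0; apply: val_inj; apply/ffunP => -[[u v] w]; rewrite [LHS]X0 [RHS]ffunE. Qed.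

(** Since l != 0, [curl X] is a nonzero eigenchain. *)
Lemma curl_adj_curl_le l X : curl_adj_curl R G X = l *: X -> l != 0 -> X != 0 ->
  l <= (D_top G 1)%:R.
Proof.
move=> eX l0 X0; have ech := curl_eigenchain eX.
have [/existsP[u /existsP[v /existsP[w nz]]]|/existsPn z] := boolP [exists u, exists v,
  exists w, curl_chain X u v w != 0].
  have := eigenchain_le ech nz; move=> /le_trans; apply.
  by rewrite ler_nat card_covered_tri.
have c0 : curl X = 0.
  apply: curl_chain_eq0 => u v w; apply/eqP; rewrite -[_ == 0]negbK.
  by have /existsPn/(_ v)/existsPn/(_ w) := z u.
move: eX; rewrite comp_lfunE !lfunE /= c0 linear0 => /esym/eqP.
by rewrite scaler_eq0 (negPf l0) (negPf X0).
Qed.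

Lemma curl_adj_curl2_le l1 l2 X1 X2 :
  curl_adj_curl R G X1 = l1 *: X1 -> curl_adj_curl R G X2 = l2 *: X2 ->
  l1 != 0 -> l2 != 0 -> lin_indep X1 X2 ->
  l1 + l2 <= (D_top G 1)%:R + (D_top G 2)%:R.
Proof.
move=> e1 e2 l10 l20 ind.
have := eigenchain2_le tri12 tri23 tri_irr (curl_eigenchain e1) (curl_eigenchain e2).
move=> H; apply: (le_trans (H _)); last first.
  by rewrite lerD // ler_nat ?card_covered_tri ?card_shared_tri.
move=> a b c0; have {}c0 : curl (a *: X1 + b *: X2) = 0.
  by apply: curl_chain_eq0 => u v w; rewrite -curl_chain_comb.
(* Applying curl^* to a dependence between the curls gives a l1 X1 + b l2 X2 = 0. *)
have [|/eqP + /eqP] := ind (a * l1) (b * l2).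
  have : curl_adj_curl R G (a *: X1 + b *: X2) = 0.
    by rewrite comp_lfunE !lfunE /= c0 linear0.
  by rewrite linearD !linearZ /= e1 e2 !scalerA.
by rewrite !mulf_eq0 (negPf l10) (negPf l20) !orbF => /eqP-> /eqP->.
Qed.

(* Coning with the apex None turns an eigenvalue l on the edges of G into the
   eigenvalue l + 1 on triples, and adds one vertex to both vertex counts. *)
Definition cone_tri (x y z : option G) : bool :=
  match x, y, z with
  | None, Some u, Some v | Some u, None, Some v | Some u, Some v, None => adj u v
  | _, _, _ => false
  end.

(** Moving the apex from either end to the middle is an odd permutation, hence the reversed edge in
    that case. *)
Definition cone_chain (X : L2E) (x y z : option G) : R :=
  match x, y, z with
  | None, Some u, Some v | Some u, Some v, None => vsval X (u, v)
  | Some u, None, Some v => vsval X (v, u)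
  | _, _, _ => 0
  end.

Lemma cone12 x y z : cone_tri y x z = cone_tri x y z.
Proof. by case: x y z => [u|] [v|] [w|] //=; rewrite adj_sym. Qed.

Lemma cone23 x y z : cone_tri x z y = cone_tri x y z.
Proof. by case: x y z => [u|] [v|] [w|] //=; rewrite adj_sym. Qed.

Lemma cone_irr x z : cone_tri x x z = false.
Proof. by case: x z => [u|] [w|] //=; rewrite adj_irrefl. Qed.

Lemma L2E_nadj (X : L2E) u v : ~~ adj u v -> vsval X (u, v) = 0.
Proof. by have /altspaceP -> := subvsP X; rewrite /is_edge /= => /negPf ->. Qed.

Lemma cone_chain_chain X : chain cone_tri (cone_chain X).
Proof.
split.
  split=> [] [u|] [v|] [w|] /=; rewrite ?oppr0 //; exact: L2E_anti.
by case=> [u|] [v|] [w|] //= nuv; apply: L2E_nadj; rewrite // adj_sym.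
Qed.

Lemma sum_option (F : option G -> R) : \sum_x F x = F None + \sum_u F (Some u).
Proof.
rewrite (bigD1 None) //=; congr (_ + _).
rewrite (reindex_omap Some id) /=; last by case.
by apply: eq_bigl => u; rewrite eqxx.
Qed.

Definition down : 'End(L2E) := - (linfun (@grad R G) \o linfun (@div R G))%VF.

Lemma down_edge l X u v : down X = l *: X -> adj u v ->
  div X u - div X v = l * vsval X (u, v).
Proof.
move=> eX uv.
have : vsval (down X) (u, v) = l * vsval X (u, v) by rewrite eX /= !ffunE.
by rewrite opp_lfunE comp_lfunE !lfunE /= !ffunE uv opprB.
Qed.

(** The boundary is [div X u] on the edge from the apex to u and X(u, v) on an edge of [G], so the
    coboundary at (None, u, v) is div X u - div X v + X(u, v) = (l + 1) X(u, v). *)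
Lemma cone_eigenchain l X : down X = l *: X ->
  eigenchain cone_tri (l + 1) (cone_chain X).
Proof.
move=> eX; split; first exact: cone_chain_chain.
have bd0 u : bd (cone_chain X) None (Some u) = div X u.
  by rewrite /bd sum_option /= add0r ffunE.
have bd1 u : bd (cone_chain X) (Some u) None = - div X u.
  by rewrite bd_anti ?bd0 //; apply: (cone_chain_chain X).1.
have bd2 u v : bd (cone_chain X) (Some u) (Some v) = vsval X (u, v).
  by rewrite /bd sum_option /= big1 ?addr0.
have e u v : adj u v -> div X u = l * vsval X (u, v) + div X v.
  by move=> uv; rewrite -(down_edge eX uv) subrK.
move=> [u|] [v|] [w|] //= a; rewrite /cobd ?bd0 ?bd1 ?bd2 (e _ _ a); try ring.
by rewrite (L2E_anti X w u); ring.
Qed.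

Lemma adj_edge (u v : G) : adj u v -> [set u; v] \in [set x in edges G | u \in x].
Proof. by move=> uv; rewrite inE in_edges uv !inE eqxx. Qed.

Lemma card_covered_cone : (#|covered cone_tri| <= (d_top G 1).+1)%N.
Proof.
have -> : (d_top G 1).+1 = (#|[set None : option G]|
    + #|[set Some v | v in [set v : G | (1 <= deg v)%N]]|)%N.
  by rewrite cards1 card_imset //; apply: Some_inj.
apply: leq_trans (leq_card_setU _ _); apply/subset_leq_card/subsetP => -[u|]; last by rewrite !inE.
rewrite !inE /= => /existsP[[v|] /existsP[[w|]]] //= uv.
  by apply: imset_f; rewrite inE; apply/card_gt0P; exists [set u; v]; apply: adj_edge.
by apply: imset_f; rewrite inE; apply/card_gt0P; exists [set u; w]; apply: adj_edge.
Qed.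

Lemma deg_gt1 (u v w : G) : adj u v -> adj u w -> v != w -> (2 <= deg u)%N.
Proof.
move=> uv uw vw; have uv' : u != v by apply: contraTneq uv => ->; rewrite adj_irrefl.
have <- : #|[set [set u; v]; [set u; w]]| = 2%N.
  rewrite cards2; suff -> : [set u; v] != [set u; w] by [].
  apply/eqP => /setP/(_ v); rewrite !inE eqxx orbT (negPf vw) orbF => /esym.
  by rewrite eq_sym (negPf uv').
by apply: subset_leq_card; rewrite subUset !sub1set !adj_edge.
Qed.

Lemma card_shared_cone : (#|shared cone_tri| <= (d_top G 2).+1)%N.
Proof.
have -> : (d_top G 2).+1 = (#|[set None : option G]|
    + #|[set Some v | v in [set v : G | (2 <= deg v)%N]]|)%N.
  by rewrite cards1 card_imset //; apply: Some_inj.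
apply: leq_trans (leq_card_setU _ _); apply/subset_leq_card/subsetP => -[u|]; last by rewrite !inE.
rewrite /shared in_set in_setU in_set1 /=.
case/existsP=> a /existsP[b /existsP[c /existsP[d /and4P[t1 t2 ca cb]]]].
apply: imset_f; rewrite inE.
(* Each triple contains the apex: one of [a], [b] is [None], so [c] is a vertex of [G], [d] is
   [None], and [u] has two distinct neighbours. *)
case: a b c d t1 t2 ca cb => [a|] [b|] [c|] [d|] //= t1 t2 ca cb.
- by apply: deg_gt1 t1 t2 _; rewrite eq_sym.
- by apply: deg_gt1 t1 t2 _; rewrite eq_sym.
Qed.

Lemma cone_chain_comb a b X Y x y z :
  comb a b (cone_chain X) (cone_chain Y) x y z = cone_chain (a *: X + b *: Y) x y z.
Proof.
by case: x y z => [u|] [v|] [w|]; rewrite /comb /= ?mulr0 ?addr0 // !ffunE.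
Qed.

Lemma cone_chain_eq0 X : (forall x y z, cone_chain X x y z = 0) -> X = 0.
Proof.
move=> X0; apply: val_inj; apply/ffunP => -[u v].
by rewrite [LHS](X0 None (Some u) (Some v)) ffunE.
Qed.

Lemma down_le l X : down X = l *: X -> X != 0 -> l <= (d_top G 1)%:R.
Proof.
move=> eX X0; have ech := cone_eigenchain eX.
have [/existsP[u /existsP[v /existsP[w nz]]]|/existsPn z] := boolP [exists u, exists v,
  exists w, cone_chain X u v w != 0].
  have := eigenchain_le ech nz.
  have : #|covered cone_tri|%:R <= (d_top G 1).+1%:R :> R by rewrite ler_nat card_covered_cone.
  by rewrite -natr1 => cc cl; rewrite -(lerD2r 1); apply: le_trans cc.
case/eqP: X0; apply: cone_chain_eq0 => u v w; apply/eqP; rewrite -[_ == 0]negbK.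
by have /existsPn/(_ v)/existsPn/(_ w) := z u.
Qed.

Lemma down2_le l1 l2 X1 X2 : down X1 = l1 *: X1 -> down X2 = l2 *: X2 ->
  lin_indep X1 X2 -> l1 + l2 <= (d_top G 1)%:R + (d_top G 2)%:R.
Proof.
move=> e1 e2 ind.
have := eigenchain2_le cone12 cone23 cone_irr (cone_eigenchain e1) (cone_eigenchain e2).
move=> /(_ _)-H.
have : (l1 + 1) + (l2 + 1) <= #|covered cone_tri|%:R + #|shared cone_tri|%:R.
  by apply: H => a b c0; apply: ind; apply: cone_chain_eq0 => x y z; rewrite -cone_chain_comb.
have : #|covered cone_tri|%:R <= (d_top G 1).+1%:R :> R by rewrite ler_nat card_covered_cone.
have : #|shared cone_tri|%:R <= (d_top G 2).+1%:R :> R by rewrite ler_nat card_shared_cone.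
rewrite -!natr1; lra.
Qed.

End Graph.

(** * Multiplicities *)

Section Multiplicity.
Variable F : fieldType.

Lemma mxrank_unit n m (L : 'M[F]_n) (M : 'M_(n, m)) : L \in unitmx -> \rank (L *m M) = \rank M.
Proof. by move=> uL; rewrite (eqmxMfull M) // row_full_unit. Qed.

(** Conjugating by [L] turns A - x into the block matrix with first block row (K11, K12) and second
    row zero, where K = U L. The rank condition makes [K11] invertible, so [x] is not a root of the
    remaining factor. *)
Lemma char_poly_semisimple_block r s (A : 'M[F]_(r + s)) x (L U : 'M_(r + s)) :
  L \in unitmx -> U \in unitmx -> A - x%:M = L *m pid_mx r *m U ->
  \rank ((A - x%:M) *m (A - x%:M)) = r ->
  exists2 g, char_poly A = ('X - x%:P) ^+ s * g & ~~ root g x.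
Proof.
move=> uL uU eA rk2.
set K := U *m L; pose K11 := ulsubmx K.
have uK11 : K11 \in unitmx.
  rewrite -row_free_unit /row_free -[X in _ == X]rk2 eA.
  have -> : L *m pid_mx r *m U *m (L *m pid_mx r *m U)
    = L *m (pid_mx r *m K *m pid_mx r *m U) by rewrite !mulmxA.
  rewrite mxrank_unit // mxrankMfree ?row_free_unit //.
  rewrite -[K]submxK pid_mx_block !mulmx_block.
  rewrite !(mulmx0, mul0mx, mul1mx, mulmx1, addr0) rank_diag_block_mx mxrank0 addn0.
  by [].
exists (\det (('X - x%:P)%:M - map_mx polyC K11)).
  pose L' := map_mx polyC L.
  have uL' : \det L' * \det (map_mx polyC (invmx L)) = 1.
    by rewrite -det_mulmx -map_mxM mulmxV // map_mx1 det1.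
  have -> : char_poly A = \det (map_mx polyC (invmx L) *m char_poly_mx A *m L').
    by rewrite !det_mulmx mulrAC [_ * \det L']mulrC uL' mul1r.
  have -> : char_poly_mx A = ('X - x%:P)%:M - map_mx polyC (A - x%:M).
    rewrite /char_poly_mx map_mxB map_scalar_mx /= raddfB /=.
    by rewrite opprB addrA subrK.
  rewrite eA mulmxBr mulmxBl mul_mx_scalar -scalemxAl -map_mxM mulVmx // map_mx1.
  rewrite -!map_mxM -!mulmxA mulKmx // -/K scalemx1 -[K]submxK pid_mx_block.
  rewrite mulmx_block !(mulmx0, mul0mx, mul1mx, mulmx1, addr0) map_block_mx.
  rewrite scalar_mx_block opp_block_mx add_block_mx !map_mx0 !oppr0 !addr0 !add0r.
  by rewrite det_ublock det_scalar mulrC.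
rewrite /root -[_.[x]]/(horner_eval x _) -det_map_mx map_mxB map_scalar_mx /=.
rewrite /horner_eval hornerXsubC subrr raddf0 sub0r.
have -> : map_mx (fun p : {poly F} => p.[x]) (map_mx polyC K11) = K11.
  by apply/matrixP => i j; rewrite !mxE hornerC.
by rewrite -unitfE -[_ \is a _]/(- K11 \in unitmx) -[- K11]scaleN1r unitmxZ ?unitrN1.
Qed.

(** Algebraic and geometric multiplicities agree when squaring A - x does not lower its rank. *)
Lemma mup_char_poly n (A : 'M[F]_n) x :
  \rank ((A - x%:M) *m (A - x%:M)) = \rank (A - x%:M) ->
  mup x (char_poly A) = (n - \rank (A - x%:M)%R)%N.
Proof.
have := mulmx_ebase (A - x%:M).
have : col_ebase (A - x%:M) \in unitmx by rewrite col_ebase_unit.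
have : row_ebase (A - x%:M) \in unitmx by rewrite row_ebase_unit.
move: (col_ebase _) (row_ebase _) => L U.
move: (\rank (A - x%:M)) (rank_leq_row (A - x%:M)) => r rn uU uL /esym eA rk2.
have [s ns] : exists s, n = (r + s)%N by exists (n - r)%N; rewrite subnKC.
move: A L U rn uU uL eA rk2; rewrite ns => A L U _ uU uL eA rk2.
have [g -> gx] := char_poly_semisimple_block uL uU eA rk2.
by rewrite mupMl // mup_XsubCX eqxx addKn.
Qed.

Lemma rank_ge2P n (C : 'M[F]_n) : reflect
  (exists u1 u2 : 'rV_n, [/\ u1 *m C = 0, u2 *m C = 0
     & forall a b : F, a *: u1 + b *: u2 = 0 -> a = 0 /\ b = 0])
  (2 <= n - \rank C)%N.
Proof.
rewrite -mxrank_ker; apply: (iffP idP) => [k2|[u1 [u2 [k1 k2 ind]]]].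
  pose K := row_base (kermx C).
  have fK : row_free K by apply: row_base_free.
  pose i0 := Ordinal (ltnW k2); pose i1 := Ordinal k2.
  have kK i : row i K *m C = 0.
    by apply/sub_kermxP; rewrite (submx_trans (row_sub i K)) // eq_row_base.
  exists (row i0 K), (row i1 K); split; rewrite ?kK // => a b e.
  have : a *: delta_mx 0 i0 + b *: delta_mx 0 i1 = 0 :> 'rV_(\rank (kermx C)).
    by apply: (row_free_inj fK); rewrite mulmxDl -!scalemxAl -!rowE e mul0mx.
  move/rowP => d0; have := d0 i0; have := d0 i1; rewrite !mxE !eqxx /=.
  by rewrite !mulr0 !mulr1 addr0 add0r => -> ->.
have <- : \rank (col_mx u1 u2) = 2%N.
  apply/eqP; apply: inj_row_free => w; rewrite -[w]hsubmxK mul_row_col.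
  rewrite [lsubmx w]mx11_scalar [rsubmx w]mx11_scalar !mul_scalar_mx => /ind[-> ->].
  by rewrite raddf0 row_mx0.
by apply: mxrankS; rewrite col_mx_sub !sub_kermx k1 k2 !eqxx.
Qed.

End Multiplicity.

Import passmx.

(** * Eigenvectors and the list of eigenvalues *)

Section Eigenvectors.
Variables (R : realType) (vT : vectType R) (f : 'End(vT)) (x : R).

Local Notation A := (mxof (vbasis fullv) (vbasis fullv) f).
Local Notation vec := (vecof (vbasis (fullv : {vspace vT}))).
Local Notation row_of := (rVof (vbasis (fullv : {vspace vT}))).

(** The kernels of f - x and of its square agree: no nontrivial Jordan block at [x]. *)
Definition semisimple_at :=
  forall v, f (f v - x *: v) = x *: (f v - x *: v) -> f v = x *: v.

Lemma vecof_mulA u : vec (u *m A) = f (vec u).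
Proof. by rewrite mul_mxof rVofK // vbasisP. Qed.

Lemma vecof_mulB u : vec (u *m (A - x%:M)) = f (vec u) - x *: vec u.
Proof. by rewrite mulmxBr mul_mx_scalar linearB linearZ /= vecof_mulA. Qed.

Lemma vecof_ker u : (u *m (A - x%:M) == 0) = (f (vec u) == x *: vec u).
Proof.
by rewrite -(vecof_eq0 (vbasisP _)) vecof_mulB subr_eq0.
Qed.

(** The rank lost by squaring is the dimension of the intersection of image and kernel, here
    zero. *)
Lemma rank_semisimple : semisimple_at ->
  \rank ((A - x%:M) *m (A - x%:M)) = \rank (A - x%:M).
Proof.
move=> ss; rewrite -[RHS](mxrank_mul_ker _ (A - x%:M)) -[LHS]addn0; congr (_ + _)%N.
apply/esym/eqP; rewrite mxrank_eq0; apply/eqP/row_matrixP => i; rewrite row0.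
set u := row i _.
have : (u <= (A - x%:M) :&: kermx (A - x%:M))%MS by apply: row_sub.
rewrite sub_capmx => /andP[/submxP[w wE] /sub_kermxP/eqP].
rewrite vecof_ker wE vecof_mulB => /eqP/ss/eqP.
by rewrite -vecof_ker => /eqP.
Qed.

Lemma mup_lchar_ge2P : semisimple_at ->
  reflect (exists v1 v2, [/\ f v1 = x *: v1, f v2 = x *: v2 & lin_indep v1 v2])
    (2 <= mup x (lchar_poly f))%N.
Proof.
move=> ss; rewrite /lchar_poly mup_char_poly; last exact: rank_semisimple.
have bV := vbasisP (fullv : {vspace vT}).
apply: (iffP (rank_ge2P _)) => [[u1 [u2 [/eqP k1 /eqP k2 ind]]]|[v1 [v2 [e1 e2 ind]]]].
  exists (vec u1), (vec u2); split; first by apply/eqP; rewrite -vecof_ker.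
    by apply/eqP; rewrite -vecof_ker.
  move=> a b; rewrite -!linearZ -linearD => /eqP.
  by rewrite vecof_eq0 // => /eqP; apply: ind.
exists (row_of v1), (row_of v2); split.
- by apply/eqP; rewrite vecof_ker rVofK // e1.
- by apply/eqP; rewrite vecof_ker rVofK // e2.
move=> a b /eqP; rewrite -!linearZ -linearD rVof_eq0 // => /eqP; exact: ind.
Qed.

Lemma lchar_poly_neq0 : lchar_poly f != 0.
Proof. exact: monic_neq0 (char_poly_monic _). Qed.

Lemma mup_lchar_gt0P :
  reflect (exists2 v, v != 0 & f v = x *: v) (0 < mup x (lchar_poly f))%N.
Proof.
rewrite -XsubC_dvd ?lchar_poly_neq0 // dvdp_XsubCl /lchar_poly -eigenvalue_root_char.
have bV := vbasisP (fullv : {vspace vT}).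
apply: (iffP eigenvalueP) => [[u e u0]|[v v0 e]].
  exists (vec u); first by rewrite vecof_eq0.
  by rewrite -vecof_mulA e linearZ.
exists (row_of v); last by rewrite rVof_eq0.
by rewrite mul_mxof rVofK // e linearZ.
Qed.

Lemma count_eigenvalues : count_mem x (eigenvalues f) = mup x (lchar_poly f).
Proof.
rewrite /eigenvalues (permP (permEl (perm_sort _ _))) count_flatten -map_comp.
have rootsP := roots_on_rootsR lchar_poly_neq0.
have inroots : (x \in rootsR (lchar_poly f)) = root (lchar_poly f) x.
  by rewrite (roots_onP rootsP) ?in_itv.
have uniq_roots : uniq (rootsR (lchar_poly f)).
  by apply: (sorted_uniq lt_trans ltxx); apply: sorted_roots.
have [xr|xr] := boolP (x \in rootsR (lchar_poly f)); last first.
  rewrite mupNroot -?inroots // sumnE big_map big_seq big1 // => y yr /=.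
  rewrite count_nseq /=; case: eqP => [e|_]; last by rewrite mul0n.
  by rewrite -e yr in xr.
rewrite sumnE big_map (bigD1_seq x) //= count_nseq /= eqxx mul1n big1 ?addn0 // => y.
by move=> yx /=; rewrite count_nseq /= (negPf yx).
Qed.

End Eigenvectors.

Lemma lin_indep_eigen (R : realType) (vT : vectType R) (f : 'End(vT)) x y X Y :
  f X = x *: X -> f Y = y *: Y ->
  X != 0 -> Y != 0 -> x != y -> lin_indep X Y.
Proof.
move=> eX eY X0 Y0 xy a b e.
have a0 : a = 0.
  have fe : a *: (x *: X) + b *: (y *: Y) = 0.
    have <- : f (a *: X + b *: Y) = 0 by rewrite e linear0.
    by rewrite -eX -eY linearD !linearZ.
  have : a *: (x *: X) + b *: (y *: Y) - y *: (a *: X + b *: Y) = 0.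
    by rewrite fe e scaler0 subrr.
  rewrite [y *: (_ + _)]scalerDr !scalerA [y * b]mulrC opprD addrACA subrr addr0.
  move=> /eqP; rewrite -scalerBl scaler_eq0 (negPf X0) orbF [y * a]mulrC -mulrBr.
  by rewrite mulf_eq0 subr_eq0 (negPf xy) orbF => /eqP.
split=> //; move: e; rewrite a0 scale0r add0r => /eqP.
by rewrite scaler_eq0 (negPf Y0) orbF => /eqP.
Qed.

(** * Hodge decomposition *)

Section Hodge.
Variables (R : realType) (G : sgraph).
Local Notation L2E := (L2E R G).
Local Notation up := (curl_adj_curl R G).
Local Notation down := (down R G).
Local Notation Delta := (helmholtzian R G).
Implicit Types (X Y : L2E).

(** Twice the standard inner product, since each edge is counted in both orders. *)
Definition edge_dot X Y : R := \sum_u \sum_v vsval X (u, v) * vsval Y (u, v).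

Lemma edge_dotC X Y : edge_dot X Y = edge_dot Y X.
Proof. by apply: eq_bigr => u _; apply: eq_bigr => v _; rewrite mulrC. Qed.

Lemma edge_dotDl X Y Z : edge_dot (X + Y) Z = edge_dot X Z + edge_dot Y Z.
Proof.
rewrite -big_split; apply: eq_bigr => u _; rewrite -big_split; apply: eq_bigr => v _.
by rewrite /= ffunE mulrDl.
Qed.

Lemma edge_dotZl a X Z : edge_dot (a *: X) Z = a * edge_dot X Z.
Proof.
rewrite mulr_sumr; apply: eq_bigr => u _; rewrite mulr_sumr; apply: eq_bigr => v _.
by rewrite /= ffunE -mulrA.
Qed.

Lemma edge_dot_eq0 X : edge_dot X X = 0 -> X = 0.
Proof.
move=> X0; apply: val_inj; apply/ffunP => -[u v].
have ge0 x y : 0 <= vsval X (x, y) * vsval X (x, y) by rewrite -expr2 sqr_ge0.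
have P1 := psumr_eq0P (fun x _ => sumr_ge0 _ (fun y _ => ge0 x y)) X0 (erefl : xpredT u).
have /eqP := psumr_eq0P (fun y _ => ge0 u y) P1 (erefl : xpredT v).
by rewrite mulf_eq0 orbb => /eqP ->; rewrite ffunE.
Qed.

(** For W = f X - x X with f W = x W, self-adjointness gives (W, W) = (X, f W - x W) = 0. *)
Lemma self_adjoint_semisimple (f : 'End(L2E)) x :
  (forall X Y, edge_dot (f X) Y = edge_dot X (f Y)) -> semisimple_at f x.
Proof.
move=> sa X; set W := f X - x *: X => fW.
apply/eqP; rewrite -subr_eq0; apply/eqP; apply: edge_dot_eq0.
rewrite -/W {1}/W -scaleNr edge_dotDl sa fW edge_dotC !edge_dotZl.
by rewrite mulNr [edge_dot W X]edge_dotC subrr.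
Qed.

Lemma upE X : up X = curl_adj (curl X).
Proof. by rewrite comp_lfunE !lfunE. Qed.

Lemma up_dot X Y : 3 * edge_dot (up X) Y
  = sum3 (fun u v w => curl_chain X u v w * curl_chain Y u v w).
Proof.
have cX := curl_chain_chain X.
have -> : edge_dot (up X) Y
    = \sum_u \sum_v bd (curl_chain X) u v * vsval Y (u, v).
  apply: eq_bigr => u _; apply: eq_bigr => v _; congr (_ * _).
  rewrite upE ffunE /=; case: ifPn => // nuv.
  rewrite /bd big1 // => w _; apply: cX.2; apply: contra nuv; exact: tri_adj.
rewrite (bd_adj (fun u v => vsval Y (u, v)) cX.1); apply: eq_sum3 => u v w.
have [t|nt] := boolP (tri u v w); last by rewrite cX.2 // !mul0r.
by rewrite [curl_chain Y u v w]ffunE -/(tri u v w) t.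
Qed.

Lemma up_adj X Y : edge_dot (up X) Y = edge_dot X (up Y).
Proof.
have n3 : 3 != 0 :> R by rewrite pnatr_eq0.
apply: (mulfI n3); rewrite [edge_dot X _]edge_dotC !up_dot.
by apply: eq_sum3 => u v w; rewrite mulrC.
Qed.

Lemma down_dot X Y : edge_dot (down X) Y = 2 * \sum_u div X u * div Y u.
Proof.
have row f : \sum_u \sum_v f u * vsval Y (u, v) = \sum_u f u * div Y u.
  by apply: eq_bigr => u _; rewrite -mulr_sumr ffunE.
have -> : edge_dot (down X) Y = (\sum_u \sum_v div X u * vsval Y (u, v))
    - \sum_u \sum_v div X v * vsval Y (u, v).
  rewrite -sumrB; apply: eq_bigr => u _; rewrite -sumrB; apply: eq_bigr => v _.
  have [uv|nuv] := boolP (adj u v); last by rewrite !(L2E_nadj Y nuv) !mulr0 subrr.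
  rewrite -mulrBl; congr (_ * _).
  by rewrite opp_lfunE comp_lfunE !lfunE /= !ffunE uv opprB.
rewrite [X in _ - X]exchange_big /=.
have -> : \sum_v \sum_u div X v * vsval Y (u, v) = - \sum_u \sum_v div X u * vsval Y (u, v).
  rewrite -sumrN; apply: eq_bigr => u _; rewrite -sumrN; apply: eq_bigr => v _.
  by rewrite L2E_anti mulrN.
rewrite opprK row; ring.
Qed.

Lemma down_adj X Y : edge_dot (down X) Y = edge_dot X (down Y).
Proof.
rewrite [edge_dot X _]edge_dotC !down_dot; congr (_ * _).
by apply: eq_bigr => u _; rewrite mulrC.
Qed.

Lemma DeltaE X : Delta X = down X + up X.
Proof. by rewrite /helmholtzian add_lfunE. Qed.

Lemma Delta_adj X Y : edge_dot (Delta X) Y = edge_dot X (Delta Y).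
Proof.
by rewrite !DeltaE edge_dotDl [RHS]edge_dotC edge_dotDl down_adj up_adj !(edge_dotC X).
Qed.

(** This is curl grad = 0. *)
Lemma up_down X : up (down X) = 0.
Proof.
suff c0 : curl (down X) = 0 by rewrite upE c0 linear0.
apply: curl_chain_eq0 => u v w.
have [t|nt] := boolP (tri u v w); last by apply: (curl_chain_chain _).2.
rewrite [LHS]ffunE -/(tri u v w) t opp_lfunE comp_lfunE !lfunE /= !ffunE /=.
have t' : tri v w u by rewrite tri23 tri12.
have t'' : tri w u v by rewrite tri12 tri23.
rewrite (tri_adj t) (tri_adj t') (tri_adj t''); ring.
Qed.

(** Both operators are self-adjoint, so the squared norm of [down (up X)] is a pairing with a value
    of [up] after [down], which is zero. *)
Lemma down_up X : down (up X) = 0.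
Proof.
apply: edge_dot_eq0; rewrite down_adj up_adj up_down.
by rewrite edge_dotC -(scale0r 0) edge_dotZl mul0r.
Qed.

Lemma up_eigen x X : Delta X = x *: X -> up (up X) = x *: up X.
Proof.
move=> eX; have -> : x *: up X = up (x *: X) by rewrite linearZ.
by rewrite -eX DeltaE linearD /= up_down add0r.
Qed.

Lemma down_eigen x X : Delta X = x *: X -> down (down X) = x *: down X.
Proof.
move=> eX; have -> : x *: down X = down (x *: X) by rewrite linearZ.
by rewrite -eX DeltaE linearD /= down_up addr0.
Qed.

Lemma up_semisimple x : semisimple_at up x.
Proof. exact: self_adjoint_semisimple up_adj. Qed.

Lemma Delta_semisimple x : semisimple_at Delta x.
Proof. exact: self_adjoint_semisimple Delta_adj. Qed.

Lemma mem_eigenvalues (f : 'End(L2E)) x :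
  reflect (exists2 X, X != 0 & f X = x *: X) (x \in eigenvalues f).
Proof.
by rewrite -has_pred1 has_count count_eigenvalues; apply: mup_lchar_gt0P.
Qed.

Lemma count_eigenvalues_ge2P (f : 'End(L2E)) x : semisimple_at f x ->
  reflect (exists X1 X2, [/\ f X1 = x *: X1, f X2 = x *: X2 & lin_indep X1 X2])
    (2 <= count_mem x (eigenvalues f))%N.
Proof. by rewrite count_eigenvalues => /mup_lchar_ge2P. Qed.

(** By [up_eigen], [up X] would be an eigenvector of [up] for [x] unless it vanishes. *)
Lemma down_of_notin_up x X : Delta X = x *: X -> x \notin eigenvalues up ->
  down X = x *: X.
Proof.
move=> eX /mem_eigenvalues nup; have [u0|u0] := eqVneq (up X) 0.
  by rewrite -eX DeltaE u0 addr0.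
by case: nup; exists (up X); rewrite // (up_eigen eX).
Qed.

Lemma up_eigenvalue_le x : x \in eigenvalues up -> x <= (D_top G 1)%:R.
Proof.
case/mem_eigenvalues=> X X0 eX; have [->|x0] := eqVneq x 0; first exact: ler0n.
exact: curl_adj_curl_le eX x0 X0.
Qed.

Lemma Delta_notin_up_le x : x = 0 \/ x \in eigenvalues Delta ->
  x \notin eigenvalues up -> x <= (d_top G 1)%:R.
Proof.
case=> [-> _|/mem_eigenvalues[X X0 eX] nup]; first exact: ler0n.
exact: down_le (down_of_notin_up eX nup) X0.
Qed.

Lemma lambda_mem i (f : 'End(L2E)) : lambda i f = 0 \/ lambda i f \in eigenvalues f.
Proof.
rewrite /lambda; have [lt|ge] := ltnP i.-1 (size (eigenvalues f)).
  by right; apply: mem_nth.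
by left; rewrite nth_default.
Qed.

Lemma lambda12_count (f : 'End(L2E)) : lambda 1 f != 0 -> lambda 1 f = lambda 2 f ->
  (2 <= count_mem (lambda 1 f) (eigenvalues f))%N.
Proof.
rewrite /lambda; case: (eigenvalues f) => [|a [|b s]] /=; rewrite ?eqxx //.
  (* With a single eigenvalue, [lambda 2] is the default 0, which l1 != 0 excludes. *)
  by move=> a0 e; rewrite e eqxx in a0.
by move=> _ <-; rewrite !eqxx.
Qed.

Lemma sub_multiset2 (s : seq R) x y : x \in s -> y \in s ->
  (x = y -> (2 <= count_mem x s)%N) -> sub_multiset [:: x; y] s.
Proof.
move=> xs ys xy z /=; rewrite addn0.
have ge1 w : w \in s -> (1 <= count_mem w s)%N by rewrite -has_count has_pred1.
have [<-|_] := eqVneq x z; have [e|_] := eqVneq y _; rewrite ?addn0 ?add0n //.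
- exact: xy (esym e).
- exact: ge1.
- by rewrite -e; apply: ge1.
Qed.

(** If [down] killed both independent eigenvectors, [x] would be repeated for [up] too; so one of
    them has a nonzero [down] image, an eigenvector of [down] for [x]. *)
Lemma repeated_eigenvalue_le x : x != 0 -> (2 <= count_mem x (eigenvalues Delta))%N ->
  ~~ (2 <= count_mem x (eigenvalues up))%N -> x <= (d_top G 1)%:R.
Proof.
move=> x0 /(count_eigenvalues_ge2P (@Delta_semisimple x))[X1 [X2 [e1 e2 ind]]].
move=> /(count_eigenvalues_ge2P (@up_semisimple x)) nup.
have dle X : Delta X = x *: X -> down X != 0 -> x <= (d_top G 1)%:R.
  by move=> eX d0; apply: down_le (down_eigen eX) d0.
have [d1|/(dle _ e1)//] := eqVneq (down X1) 0.
have [d2|/(dle _ e2)//] := eqVneq (down X2) 0.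
case: nup; exists X1, X2; split=> //.
  by rewrite -e1 DeltaE d1 add0r.
by rewrite -e2 DeltaE d2 add0r.
Qed.

End Hodge.

(** * The three bounds *)

Theorem corollary1 (R : realType) (G : sgraph) :
  let l1 := lambda 1 (helmholtzian R G) in
  let l2 := lambda 2 (helmholtzian R G) in
  let s := eigenvalues (curl_adj_curl R G) in
  [/\ sub_multiset [:: l1; l2] s ->
        l1 + l2 <= (D_top G 1)%:R + (D_top G 2)%:R,
      l1 \notin s /\ l2 \notin s ->
        l1 + l2 <= (d_top G 1)%:R + (d_top G 2)%:R
    & ~ sub_multiset [:: l1; l2] s -> ~ (l1 \notin s /\ l2 \notin s) ->
        l1 + l2 <= (d_top G 1)%:R + (D_top G 1)%:R].
Proof.
move=> l1 l2 s.
have m1 : l1 = 0 \/ _ := lambda_mem 1 (helmholtzian R G).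
have m2 : l2 = 0 \/ _ := lambda_mem 2 (helmholtzian R G).
have cD := @lambda12_count R G (helmholtzian R G); rewrite -/l1 -/l2 in cD.
split.
- move=> sub.
  have l1s : l1 \in s.
    by rewrite -has_pred1 has_count (leq_trans _ (sub l1)) //= eqxx.
  have l2s : l2 \in s.
    by rewrite -has_pred1 has_count (leq_trans _ (sub l2)) //= eqxx addn0 addn1.
  have D1 := up_eigenvalue_le l1s; have D2 := up_eigenvalue_le l2s.
  have [e1|l10] := eqVneq l1 0; first by rewrite e1 add0r (le_trans D2) // lerDl.
  have [e2|l20] := eqVneq l2 0; first by rewrite e2 addr0 (le_trans D1) // lerDl.
  have [e12|ne12] := eqVneq l1 l2.
    (* For equal values the multiset hypothesis itself provides two independent eigenvectors of
       curl^* curl. *)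
    have : (2 <= count_mem l1 s)%N.
      by apply: leq_trans (sub l1); rewrite /= e12 eqxx.
    case/(count_eigenvalues_ge2P (@up_semisimple R G l1)) => X1 [X2 [eX1 eX2 ind]].
    by rewrite e12 in eX2; apply: curl_adj_curl2_le eX1 eX2 l10 l20 ind.
  case/mem_eigenvalues: l1s => X1 X10 eX1; case/mem_eigenvalues: l2s => X2 X20 eX2.
  exact: curl_adj_curl2_le eX1 eX2 l10 l20 (lin_indep_eigen eX1 eX2 X10 X20 ne12).
- case=> l1s l2s.
  have d1 := Delta_notin_up_le m1 l1s; have d2 := Delta_notin_up_le m2 l2s.
  have [e1|l10] := eqVneq l1 0; first by rewrite e1 add0r (le_trans d2) // lerDl.
  have [e2|l20] := eqVneq l2 0; first by rewrite e2 addr0 (le_trans d1) // lerDl.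
  have [e12|ne12] := eqVneq l1 l2.
    (* A repeated nonzero value has two independent eigenvectors of the Helmholtzian, and both are
       eigenvectors of - grad div. *)
    case/(count_eigenvalues_ge2P (@Delta_semisimple R G l1)): (cD l10 e12)
      => X1 [X2 [eX1 eX2 ind]].
    have dX2 := down_of_notin_up eX2 l1s; rewrite e12 in dX2.
    exact: down2_le (down_of_notin_up eX1 l1s) dX2 ind.
  case: m1 l10 => [->|/mem_eigenvalues[X1 X10 eX1] _]; first by rewrite eqxx.
  case: m2 l20 => [->|/mem_eigenvalues[X2 X20 eX2] _]; first by rewrite eqxx.
  apply: down2_le (down_of_notin_up eX1 l1s) (down_of_notin_up eX2 l2s) _.
  exact: lin_indep_eigen eX1 eX2 X10 X20 ne12.
move=> nsub nout.
have [l1s|l1s] := boolP (l1 \in s); have [l2s|l2s] := boolP (l2 \in s).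
(* Both values lie in [s] while the multiset inclusion fails, so they coincide and [s] contains the
   value only once; one copy is then bounded through the edges. *)
- have e12 : l1 = l2.
    apply/eqP/contraT => ne; case: nsub; apply: sub_multiset2 => // e.
    by rewrite e eqxx in ne.
  rewrite -e12; apply: lerD; last exact: up_eigenvalue_le.
  have [->|l10] := eqVneq l1 0; first exact: ler0n.
  apply: repeated_eigenvalue_le (cD l10 e12) _ => //.
  by apply/negP => c2; apply: nsub; apply: sub_multiset2.
- by rewrite addrC; apply: lerD; [apply: Delta_notin_up_le m2 l2s | apply: up_eigenvalue_le].
- by apply: lerD; [apply: Delta_notin_up_le m1 l1s | apply: up_eigenvalue_le].
- by case: nout.
Qed.
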